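(* Let $T$ be a Coppersmith--Winograd-like estimated symmetric partitioned tensor. For any $\rho\in[2,3]$, \[\log V^{\mathrm{m}}_\rho(T)\le\max_{P\in\mathrm{sdist}(T)}\Big[H(P_{\mathrm m})+\sum_{s\in\operatorname{supp}(T)}P(s)\log\mathrm{Val}_\rho(T_s)+\frac{\rho-2}{3}\,P_0\,H(\tilde P)\Big].\]
   Context: Logarithms base 2; $H$ is the Shannon entropy (with $0\log0=0$). Tensors are trilinear forms $\sum T_{xyz}xyz$ over a field on finite variable sets; equivalent tensors differ by bijective renamings of $x$-, $y$-, $z$-variables separately; $\langle n,m,p\rangle=\sum x_{ij}y_{jk}z_{ki}$, tensors equivalent to it are matrix multiplication tensors, of volume $nmp$. Partitioned tensor: $X=\bigsqcup_{i\in I}X_i$, $Y=\bigsqcup_{j\in J}Y_j$, $Z=\bigsqcup_{k\in K}Z_k$, $T=\sum_sT_s$ with each constituent $T_s$ a nonzero tensor over $X_i,Y_j,Z_k$ for an annotation $s=(i,j,k)$, distinct constituents having distinct annotations; $\operatorname{supp}(T)$ = annotations. $T^{\otimes N}$ is partitioned by products of parts, with constituents $T^{\otimes N}_s=\bigotimes_tT_{s_t}$, $s\in\operatorname{supp}(T)^N$. Symmetric: $I=J=K$ and $T_{(i,j,k)}\approx T_{(j,k,i)}$. Partitioned restriction: zero all variables of some parts. Estimated: functions $\rho\mapsto\mathrm{Val}_\rho(T_s)\ge0$ on $[2,3]$ with $\mathrm{Val}_\rho(T_s)=\mathrm{Vol}(T_s)^{\rho/3}$ when $T_s$ is a matrix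 multiplication tensor. Coppersmith--Winograd-like: (1) $X$ is partitioned into $X_0,\dots,X_D$ with $|X_0|=|X_D|=1$ and $|X_i|>1$ for $0<i<D$, similarly $Y,Z$; (2) constituents with annotation $(\alpha,\beta,\gamma)$, $\alpha,\beta,\gamma\ne0$, are not matrix multiplication tensors; (3) if $(\alpha,\beta,0)\in\operatorname{supp}(T)$ then $|X_\alpha|=|Y_\beta|=m$ and $T_{\alpha,\beta,0}=\sum_{i=1}^mx_iy_iz$ for enumerations $X_\alpha=\{x_i\}$, $Y_\beta=\{y_i\}$, $Z_0=\{z\}$, and similarly for $(\alpha,0,\beta)$, $(0,\alpha,\beta)$; (4) the only annotations with all entries in $\{0,D\}$ are $(D,0,0),(0,D,0),(0,0,D)$. Merging value: $\operatorname{supp}_0(T)$ = annotations with $T_s$ a matrix multiplication tensor, $\operatorname{supp}_*(T)$ the rest. Pattern $\pi:[N]\to\operatorname{supp}_*(T)\cup\{0\}$; $T^{\otimes N}_s$ conforms to $\pi$ if $s_t=\pi(t)$ when $\pi(t)\ne0$ and $s_t\in\operatorname{supp}_0(T)$ when $\pi(t)=0$; $T^{(0)}_s=\bigotimes_{\pi(t)=0}T_{s_t}$. A sum $S$ of distinct constituents of $T^{\otimes N}$ is consistent if all conform to a common $\pi$ and $\sum T^{(0)}_s$ is equivalent to a matrix multiplication tensor $S^{(0)}$; $\mathrm{Val}_\rho(S)=\mathrm{Vol}(S^{(0)})^{\rho/3}\prod_{\pi(t)\ne0}\mathrm{Val}_\rho(T_{\pi(t)})$. A consistent restriction of $T^{\otimes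 N}$: from a partitioned restriction $R$ of $T^{\otimes N}$, partition its constituents into classes each summing to a consistent sum, sums of distinct classes having pairwise disjoint $x$-, $y$-, $z$-variables. $V^{\mathrm{m}}_{\rho,N}(T)$ = max over consistent restrictions of the total $\mathrm{Val}_\rho$ of class sums; $V^{\mathrm{m}}_\rho(T)=\lim_NV^{\mathrm{m}}_{\rho,N}(T)^{1/N}$. Distributions: $\mathrm{sdist}(T)$ is the set of probability distributions $P$ on $\operatorname{supp}(T)$ with $P(i,j,k)=P(j,k,i)$. For such $P$: $P_0=\sum_{s\in\operatorname{supp}_0(T)}P(s)$; $P^*(s)=P(s)$ for $s\in\operatorname{supp}_*(T)$ and $0$ otherwise; $P_{\mathrm m}(i)=\sum_{(i,j,k)\in\operatorname{supp}(T)}P(i,j,k)$ and $P^*_{\mathrm m}(i)=\sum_{(i,j,k)}P^*(i,j,k)$; $\tilde P(0)=\frac{3}{2P_0}(P_{\mathrm m}(0)-\frac{P_0}{3})$ and $\tilde P(i)=\frac{3}{2P_0}(P_{\mathrm m}(i)-P^*_{\mathrm m}(i))$ for $i\ne0$ (a probability distribution). When $P_0=0$, the term $P_0H(\tilde P)$ is taken to be $0$.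
   Formalization: It is additionally assumed that Val_ρ(T_(i,j,k)) = Val_ρ(T_(j,k,i)) for ρ in [2,3], without which the inequality fails; ''T_(i,j,k) ≈ T_(j,k,i)'' is read after cyclically rotating the roles of the x-, y- and z-variables. *)

(* Defs.v *)
From HB Require Import structures.
From mathcomp Require Import all_boot all_order all_algebra.
From mathcomp Require Import all_classical all_reals all_analysis.
Set Implicit Arguments.
Unset Strict Implicit.
Unset Printing Implicit Defensive.
Import Order.TTheory GRing.Theory Num.Theory.
Import numFieldNormedType.Exports.
Local Open Scope ring_scope.

(* The trilinear form \sum_(x, y, z) tcoef x y z * x * y * z.  The variable
   sets belong to the tensor, also when some variable has only zero
   coefficients. *)
Record tensor (F : fieldType) := Tensor {
  varX : finType;
  varY : finType;
  varZ : finType;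
  tcoef : varX -> varY -> varZ -> F }.
Arguments Tensor {F}.

Definition tequiv (F : fieldType) (T U : tensor F) : Prop :=
  exists (f : varX T -> varX U) (g : varY T -> varY U) (h : varZ T -> varZ U),
    [/\ bijective f, bijective g, bijective h &
        forall x y z, tcoef (f x) (g y) (h z) = tcoef x y z].

(* The same form with y, z, x taken as first, second, third variables. *)
Definition trot (F : fieldType) (T : tensor F) : tensor F :=
  Tensor (varY T) (varZ T) (varX T) (fun y z x => tcoef x y z).

Definition subtensor (F : fieldType) (X Y Z : finType) (c : X -> Y -> Z -> F)
    (A : {set X}) (B : {set Y}) (C : {set Z}) : tensor F :=
  Tensor {x : X | x \in A} {y : Y | y \in B} {z : Z | z \in C}
    (fun x y z => c (val x) (val y) (val z)).

Definition matmul (F : fieldType) (n m p : nat) : tensor F :=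
  Tensor ('I_n * 'I_m)%type ('I_m * 'I_p)%type ('I_p * 'I_n)%type
    (fun x y z => [&& x.2 == y.1, y.2 == z.1 & z.2 == x.1]%:R).

Definition mm_volume (F : fieldType) (T : tensor F) (v : nat) : Prop :=
  exists n m p, [/\ (0 < n)%N, (0 < m)%N, (0 < p)%N, v = (n * m * p)%N &
                    tequiv T (matmul F n m p)].

Definition is_matmul (F : fieldType) (T : tensor F) : Prop :=
  exists v, mm_volume T v.

(* mm_volume T v determines v, because v ^ 2 = #|varX T| #|varY T| #|varZ T|;
   the default 0 is only used when T is not a matrix multiplication tensor. *)
Definition Vol (F : fieldType) (T : tensor F) : nat :=
  xget 0%N [set v | mm_volume T v]%classic.

(* A partition of the x-variables into parts indexed by I is given by the map
   sending a variable to the index of its part. *)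
Record ptensor (F : fieldType) (I J K : finType) := PTensor {
  ptens :> tensor F;
  partX : varX ptens -> I;
  partY : varY ptens -> J;
  partZ : varZ ptens -> K }.
Arguments PTensor {F I J K}.

Section Constituents.
Variables (F : fieldType) (I J K : finType) (T : ptensor F I J K).
Implicit Types (s : I * J * K) (S : {set I * J * K}).

Definition blockcoef s (x : varX T) (y : varY T) (z : varZ T) : F :=
  if (partX x, partY y, partZ z) == s then tcoef x y z else 0.

Definition constituent s : tensor F :=
  subtensor (blockcoef s) [set x | partX x == s.1.1] [set y | partY y == s.1.2]
    [set z | partZ z == s.2].

Definition supp : {set I * J * K} :=
  [set s | [exists x, [exists y, [exists z, @blockcoef s x y z != 0]]]].

Definition supp0 : {set I * J * K} :=
  [set s in supp | `[< is_matmul (constituent s) >]].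

Definition suppstar : {set I * J * K} := supp :\: supp0.

Definition sumX S : {set varX T} :=
  [set x | [exists s in S, partX x == s.1.1]].
Definition sumY S : {set varY T} :=
  [set y | [exists s in S, partY y == s.1.2]].
Definition sumZ S : {set varZ T} :=
  [set z | [exists s in S, partZ z == s.2]].

(* The sum of the constituents with annotation in S, as a tensor over the
   union of the variable sets of these constituents. *)
Definition constituent_sum S : tensor F :=
  subtensor (fun x y z => \sum_(s in S) blockcoef s x y z)
    (sumX S) (sumY S) (sumZ S).

(* The constituents left after zeroing all variables of the parts whose index
   is outside A, B, C. *)
Definition restrict_supp (A : {set I}) (B : {set J}) (C : {set K}) :
    {set I * J * K} :=
  [set s in supp | [&& s.1.1 \in A, s.1.2 \in B & s.2 \in C]].

End Constituents.

(* The tensor power with factors indexed by E, partitioned by products of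
   parts.  It is used with E = 'I_N, and with E the set of coordinates where
   a pattern vanishes. *)
Definition tpow (F : fieldType) (I J K : finType) (T : ptensor F I J K)
    (E : finType) :
    ptensor F {ffun E -> I} {ffun E -> J} {ffun E -> K} :=
  PTensor
    (Tensor {ffun E -> varX T} {ffun E -> varY T} {ffun E -> varZ T}
       (fun x y z => \prod_(t : E) tcoef (x t) (y t) (z t)))
    (fun x => [ffun t => partX (x t)])
    (fun y => [ffun t => partY (y t)])
    (fun z => [ffun t => partZ (z t)]).

(* An annotation of a tensor power is a triple of functions on E. *)
Notation pannot I J K E :=
  ({ffun E -> I} * {ffun E -> J} * {ffun E -> K})%type.

Definition acoord (I J K E : finType) (s : pannot I J K E) (t : E) : I * J * K :=
  (s.1.1 t, s.1.2 t, s.2 t).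

Section Merging.
Variables (F : fieldType) (I J K : finType) (T : ptensor F I J K) (N : nat).
Implicit Types (s : pannot I J K 'I_N) (S : {set pannot I J K 'I_N}).

(* The symbol 0 of a pattern is None. *)
Definition pattern := {ffun 'I_N -> option (I * J * K)}.

Definition is_pattern (pi : pattern) : Prop :=
  forall t a, pi t = Some a -> a \in suppstar T.

Definition conforms s (pi : pattern) : Prop :=
  forall t, if pi t is Some a then acoord s t = a else acoord s t \in supp0 T.

Definition zeros (pi : pattern) : finType := {t : 'I_N | pi t == None}.

Definition arestrict (pi : pattern) s : pannot I J K (zeros pi) :=
  ([ffun t => s.1.1 (val t)], [ffun t => s.1.2 (val t)], [ffun t => s.2 (val t)]).

(* S^(0); distinct annotations conforming to pi have distinct restrictions to
   zeros pi, so no term is lost by taking the image. *)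
Definition sum0 (pi : pattern) S : tensor F :=
  constituent_sum (tpow T (zeros pi)) (arestrict pi @: S).

Definition consistent_for S (pi : pattern) : Prop :=
  [/\ is_pattern pi, forall s, s \in S -> conforms s pi & is_matmul (sum0 pi S)].

Definition consistent S : Prop := exists pi, consistent_for S pi.

(* A nonempty S conforms to at most one pattern. *)
Definition pattern_of S : pattern :=
  xget [ffun => None] [set pi | consistent_for S pi]%classic.

(* A consistent restriction is given by the indices A, B, C of the parts that
   are kept and by the set Q of classes of the remaining constituents. *)
Definition consistent_restriction (A : {set {ffun 'I_N -> I}})
    (B : {set {ffun 'I_N -> J}}) (C : {set {ffun 'I_N -> K}})
    (Q : {set {set pannot I J K 'I_N}}) : Prop :=
  let TN := tpow T 'I_N in
  [/\ finset.partition Q (restrict_supp TN A B C),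
      forall S, S \in Q -> consistent S &
      forall S S', S \in Q -> S' \in Q -> S != S' ->
        [/\ [disjoint sumX TN S & sumX TN S'],
            [disjoint sumY TN S & sumY TN S'] &
            [disjoint sumZ TN S & sumZ TN S']]].

End Merging.

Section Values.
Variables (R : realType) (F : fieldType) (I J K : finType).
Variables (T : ptensor F I J K) (Val : R -> I * J * K -> R).

Definition estimated : Prop :=
  forall rho s, 2 <= rho <= 3 -> s \in supp T ->
    0 <= Val rho s /\
    (is_matmul (constituent T s) ->
       Val rho s = (Vol (constituent T s))%:R `^ (rho / 3)).

Definition sum_value (rho : R) (N : nat) (S : {set pannot I J K 'I_N}) : R :=
  let pi := pattern_of T S in
  (Vol (sum0 T pi S))%:R `^ (rho / 3) *
  \prod_(t < N) (if pi t is Some a then Val rho a else 1).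

(* The values are nonnegative and zeroing all variables gives total value 0, so
   starting the maximum at 0 is harmless. *)
Definition VmN (rho : R) (N : nat) : R :=
  \big[Num.max/0]_(r : {set {ffun 'I_N -> I}} * {set {ffun 'I_N -> J}}
      * {set {ffun 'I_N -> K}} * {set {set pannot I J K 'I_N}}
      | `[< consistent_restriction T r.1.1.1 r.1.1.2 r.1.2 r.2 >])
    \sum_(S in r.2) sum_value rho S.

Definition Vm (rho : R) : R :=
  limn (fun N : nat => VmN rho N `^ (N%:R^-1)).

End Values.

(* Equivalence does not permute the three sets of variables, while T_(i,j,k) is
   over X_i, Y_j, Z_k and T_(j,k,i) is over X_j, Y_k, Z_i: they are compared
   after rotating the roles of x, y, z. *)
Definition symmetric_ptensor (F : fieldType) (I : finType)
    (T : ptensor F I I I) : Prop :=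
  forall i j k, (i, j, k) \in supp T ->
    tequiv (trot (constituent T (i, j, k))) (constituent T (j, k, i)).

Definition symmetric_values (R : realType) (F : fieldType) (I : finType)
    (T : ptensor F I I I) (Val : R -> I * I * I -> R) : Prop :=
  forall rho i j k, 2 <= rho <= 3 -> (i, j, k) \in supp T ->
    Val rho (i, j, k) = Val rho (j, k, i).

(* The bijections in tequiv are the enumerations of the parts, so that the third
   condition contains |X_a| = |Y_b| = m (and its two analogues).  The last one
   says that the support meets {0, D}^3 exactly in the three listed
   annotations. *)
Definition cw_like (F : fieldType) (D : nat)
    (T : ptensor F 'I_D.+1 'I_D.+1 'I_D.+1) : Prop :=
  let sX i := #|[set x : varX T | partX x == i]| in
  let sY i := #|[set y : varY T | partY y == i]| in
  let sZ i := #|[set z : varZ T | partZ z == i]| in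
  [/\ [/\ sX ord0 = 1%N, sY ord0 = 1%N & sZ ord0 = 1%N] /\
      [/\ sX ord_max = 1%N, sY ord_max = 1%N & sZ ord_max = 1%N] /\
      (forall i : 'I_D.+1, (0 < i < D)%N ->
         [/\ (1 < sX i)%N, (1 < sY i)%N & (1 < sZ i)%N]),
      forall a b c, (a, b, c) \in supp T -> a != ord0 -> b != ord0 ->
        c != ord0 -> ~ is_matmul (constituent T (a, b, c)),
      forall a b : 'I_D.+1,
        [/\ (a, b, ord0) \in supp T -> exists m,
              tequiv (constituent T (a, b, ord0))
                (Tensor 'I_m 'I_m unit (fun i j _ => (i == j)%:R)),
            (a, ord0, b) \in supp T -> exists m,
              tequiv (constituent T (a, ord0, b))
                (Tensor 'I_m unit 'I_m (fun i _ k => (i == k)%:R)) &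
            (ord0, a, b) \in supp T -> exists m,
              tequiv (constituent T (ord0, a, b))
                (Tensor unit 'I_m 'I_m (fun _ j k => (j == k)%:R))] &
      forall a b c : 'I_D.+1,
        a \in [:: ord0; ord_max] -> b \in [:: ord0; ord_max] ->
        c \in [:: ord0; ord_max] ->
        ((a, b, c) \in supp T) =
        ((a, b, c) \in [:: (ord_max, ord0, ord0); (ord0, ord_max, ord0);
                           (ord0, ord0, ord_max)])].

Section Entropy.
Variable R : realType.

(* ln vanishes at 0, whence 0 log 0 = 0 here. *)
Definition entropy (A : finType) (p : A -> R) : R :=
  - \sum_(a : A) p a * (ln (p a) / ln 2).

(* The logarithm as an extended real, with log 0 = -oo; in the objective below
   0 * -oo = 0. *)
Definition elog2 (x : R) : \bar R := (lne x%:E * ((ln 2)^-1)%:E)%E.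

End Entropy.

Section Distributions.
Variables (R : realType) (F : fieldType) (n : nat).
Variable T : ptensor F 'I_n.+1 'I_n.+1 'I_n.+1.
Local Notation I := ('I_n.+1).
Implicit Type P : {ffun I * I * I -> R}.

Definition sdist P : Prop :=
  [/\ forall s, 0 <= P s,
      forall s, s \notin supp T -> P s = 0,
      \sum_s P s = 1 &
      forall i j k, P (i, j, k) = P (j, k, i)].

Definition P0 P : R := \sum_(s in supp0 T) P s.

Definition Pstar P : {ffun I * I * I -> R} :=
  [ffun s => if s \in suppstar T then P s else 0].

Definition marginal P (i : I) : R := \sum_(s in supp T | s.1.1 == i) P s.

(* When P0 P = 0 this is the zero function, so P0 P * entropy (Ptilde P) = 0. *)
Definition Ptilde P (i : I) : R :=
  3 / (2 * P0 P) *
  (if i == ord0 then marginal P ord0 - P0 P / 3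
   else marginal P i - marginal (Pstar P) i).

Definition objective (Val : R -> I * I * I -> R) (rho : R) P : \bar R :=
  ((entropy (marginal P))%:E
   + \sum_(s in supp T) (P s)%:E * elog2 (Val rho s)
   + ((rho - 2) / 3 * (P0 P * entropy (Ptilde P)))%:E)%E.

End Distributions.

(* Main.v *)
Require Import Defs.
From HB Require Import structures.
From mathcomp Require Import all_boot all_order all_algebra.
From mathcomp Require Import all_classical all_reals all_analysis.
From mathcomp Require Import ring lra.
Set Implicit Arguments.
Unset Strict Implicit.
Unset Printing Implicit Defensive.
Import Order.TTheory GRing.Theory Num.Theory.
Import numFieldNormedType.Exports.
Local Open Scope ring_scope.

(* The variables of S^(0) ~ <n, m, p> are indexed by pairs (i, j), (j, k),
   (k, i), so the number of annotations in a consistent sum S is controlled, by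
   the Cauchy-Schwarz (Loomis-Whitney) inequality for triangles, by weights on
   its x-, y- and z-indices.  The weights are used twice, on the annotations of S
   of a fixed type: the products of P_m, which sum to at most 1 over all the
   classes because these have disjoint indices, bound the total of the 2/3 powers
   of the numbers of annotations by 2^(N H(P_m)); and products of Ptilde bound
   each such number by 2^(N P_0 H(Ptilde)).  The second use needs that, at every
   zero coordinate of the pattern, one of x, y, z has index 0 in all the
   annotations of S; this follows from the grid structure of <n, m, p> and from
   the shape T_(a,b,0) = sum_i x_i y_i z.  There are only polynomially many
   types, and this factor disappears in the limit of the N-th roots. *)

(** The exponent splits as rho/3 = 2/3 + (rho-2)/3. The power 2/3 is the one that can be summed over
    the classes: Loomis-Whitney bounds the square of the number of annotations of type tau in a
    class by a product of three index sums, and the cube root of this product is at most their mean.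
    What is left of the exponent has to be bounded class by class; this is the origin of the term
    with Ptilde, and rho >= 2 makes its exponent nonnegative. A type need not be invariant under
    rotation. But the product of the x-, y- and z-weights of an annotation only sees how often each
    index occurs in the three positions together, so the type may be replaced by its average over
    rotations, which lies in sdist(T). An annotation has three entries per coordinate, and two once
    a zero is removed; hence the exponents 3 N H(P_m) and 2 N P_0 H(Ptilde) in the bounds for the
    squares. Since Val may vanish, the objective can be -oo on a part of sdist(T); the maximum is
    sought on the compact set where it is finite. *)

Lemma cauchy_schwarz_sum (R : realFieldType) (I : finType) (f g : I -> R) :
  (\sum_i f i * g i) ^+ 2 <= (\sum_i f i ^+ 2) * (\sum_i g i ^+ 2).
Proof.
have H : 0 <= \sum_i \sum_j (f i * g j - f j * g i) ^+ 2.
  by apply: sumr_ge0 => i _; apply: sumr_ge0 => j _; apply: sqr_ge0.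
(* Lagrange's identity. *)
have E : \sum_i \sum_j (f i * g j - f j * g i) ^+ 2 =
    2 * ((\sum_i f i ^+ 2) * (\sum_i g i ^+ 2) - (\sum_i f i * g i) ^+ 2).
  transitivity (\sum_i \sum_j (f i ^+ 2 * g j ^+ 2 + g i ^+ 2 * f j ^+ 2
      - 2 * ((f i * g i) * (f j * g j)))).
    by apply: eq_bigr => i _; apply: eq_bigr => j _; ring.
  under eq_bigr => i _ do rewrite big_split big_split /= -!mulr_sumr sumrN -!mulr_sumr.
  rewrite !big_split /= -!mulr_suml sumrN -mulr_sumr -mulr_suml; ring.
by move: H; rewrite E; lra.
Qed.

(** Cauchy-Schwarz is applied over the pairs (j, k), and then over i for each fixed pair; the
    resulting bound factors into a sum over (i, j) and a sum over (k, i). *)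
Lemma triangle_cauchy_schwarz (R : realFieldType) (I J K : finType)
    (f : I * J -> R) (g : J * K -> R) (h : K * I -> R) :
  (\sum_j \sum_k \sum_i f (i, j) * g (j, k) * h (k, i)) ^+ 2 <=
  (\sum_x f x ^+ 2) * (\sum_y g y ^+ 2) * (\sum_z h z ^+ 2).
Proof.
have -> : \sum_j \sum_k \sum_i f (i, j) * g (j, k) * h (k, i) =
    \sum_(y : J * K) g y * \sum_i f (i, y.1) * h (y.2, i).
  rewrite pair_big /=; apply: eq_bigr => -[j k] _ /=.
  by rewrite mulr_sumr; apply: eq_bigr => i _; ring.
apply: le_trans (cauchy_schwarz_sum _ _) _.
rewrite [leRHS]mulrAC mulrC ler_wpM2r//; first by apply: sumr_ge0 => *; exact: sqr_ge0.
apply: (@le_trans _ _ (\sum_(y : J * K)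
   (\sum_i f (i, y.1) ^+ 2) * (\sum_i h (y.2, i) ^+ 2))).
  by apply: ler_sum => y _; exact: cauchy_schwarz_sum.
rewrite -(pair_big xpredT xpredT (fun j k =>
   (\sum_i f (i, j) ^+ 2) * (\sum_i h (k, i) ^+ 2))) /=.
under eq_bigr => j _ do rewrite -mulr_sumr.
rewrite -mulr_suml exchange_big/=.
rewrite (pair_big xpredT xpredT (fun i j => f (i, j) ^+ 2)).
rewrite (pair_big xpredT xpredT (fun k i => h (k, i) ^+ 2)).
have -> : \sum_(p | true && true) f (p.1, p.2) ^+ 2 = \sum_x f x ^+ 2.
  by apply: eq_bigr => -[].
have -> // : \sum_(p | true && true) h (p.1, p.2) ^+ 2 = \sum_x h x ^+ 2.
by apply: eq_bigr => -[].
Qed.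

(* Weighted Loomis-Whitney inequality for the triples of a matrix
   multiplication tensor. *)
Lemma triangle_sqrt_sum (R : rcfType) (I J K : finType)
    (a : I * J -> R) (b : J * K -> R) (c : K * I -> R) :
  (forall x, 0 <= a x) -> (forall y, 0 <= b y) -> (forall z, 0 <= c z) ->
  (\sum_j \sum_k \sum_i Num.sqrt (a (i, j) * b (j, k) * c (k, i))) ^+ 2 <=
  (\sum_x a x) * (\sum_y b y) * (\sum_z c z).
Proof.
move=> a0 b0 c0.
under eq_bigr => j _ do under eq_bigr => k _ do under eq_bigr => i _ do
  rewrite !sqrtrM ?mulr_ge0//.
apply: le_trans (triangle_cauchy_schwarz (fun x => Num.sqrt (a x))
  (fun x => Num.sqrt (b x)) (fun x => Num.sqrt (c x))) _.
by rewrite !(eq_bigr _ (fun i _ => sqr_sqrtr _)).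
Qed.

(** * Powers, entropy and limits of N-th roots *)

Section RealLemmas.
Variable R : realType.
Implicit Types (A B C x y p : R).

(** This turns a product of x-, y- and z-sums into a linear expression, which can be added over the
    classes. *)
Lemma cube_root_amgm A B C : 0 <= A -> 0 <= B -> 0 <= C ->
  (A * B * C) `^ 3^-1 <= (A + B + C) / 3.
Proof.
move=> A0 B0 C0; set m := (A + B + C) / 3.
have m0 : 0 <= m by rewrite /m; lra.
have -> : m = (m ^+ 3) `^ 3^-1.
  by rewrite -powR_mulrn// -powRrM divff ?powRr1// pnatr_eq0.
apply: ge0_ler_powR; rewrite ?invr_ge0 ?nnegrE ?(mulr_ge0 (mulr_ge0 A0 B0) C0) ?exprn_ge0//.
suff : 0 <= ((A + B + C) / 3) ^+ 3 - A * B * C by rewrite subr_ge0.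
(* The first summand is A^3 + B^3 + C^3 - 3ABC in factored form; the second collects the remaining
   mixed terms as squares with nonnegative coefficients. *)
have -> : ((A + B + C) / 3) ^+ 3 - A * B * C =
  ((A + B + C) * ((A - B) ^+ 2 + (B - C) ^+ 2 + (C - A) ^+ 2) * (1/2)
   + 3 * (A * (B - C) ^+ 2 + B * (C - A) ^+ 2 + C * (A - B) ^+ 2)) / 27 by field.
apply: divr_ge0 => //; apply: addr_ge0; apply: mulr_ge0 => //.
- by apply: mulr_ge0; rewrite !addr_ge0 ?sqr_ge0.
- by rewrite !addr_ge0// mulr_ge0 ?sqr_ge0.
Qed.

(** After division by the total all terms lie in [0, 1], where x <= x^p. It serves to split the
    volume of a class by types. *)
Lemma powR_sum_le (J : finType) (a : J -> R) p : (forall i, 0 <= a i) ->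
  0 < p <= 1 -> (\sum_i a i) `^ p <= \sum_i a i `^ p.
Proof.
move=> a0 /andP[p0 p1]; set A := \sum_i a i.
have [A0|A0] := eqVneq A 0.
  by rewrite A0 powR0 ?gt_eqF// sumr_ge0// => i _; exact: powR_ge0.
have Agt : 0 < A by rewrite lt_neqAle eq_sym A0 sumr_ge0.
have Ap : 0 < A `^ p by exact: powR_gt0.
suff : 1 <= \sum_i (a i / A) `^ p.
  under eq_bigr => i _ do rewrite powRM ?invr_ge0 ?(ltW Agt)//.
  rewrite -mulr_suml -(ler_pM2r Ap) mul1r -mulrA -powRM ?invr_ge0 ?(ltW Agt)//.
  by rewrite mulVf// powR1 mulr1.
have {1}-> : 1 = \sum_i a i / A by rewrite -mulr_suml divff.
apply: ler_sum => i _.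
have [->|ai0] := eqVneq (a i) 0; first by rewrite mul0r powR_ge0.
apply: ger1_powR => //; apply/andP; split.
  by rewrite divr_gt0// lt_neqAle eq_sym ai0 a0.
rewrite ler_pdivrMr// mul1r /A (bigD1 i)//= lerDl.
by apply: sumr_ge0.
Qed.

Lemma ln2_gt0 : 0 < ln 2 :> R.
Proof. by apply: ln_gt0; rewrite ltr1n. Qed.

(** The probability of a sequence in which i occurs c p(i) times is 2^(-c H(p)). A value p(i) = 0
    forces the exponent 0, so the convention for ln 0 agrees with 0^0 = 1. *)
Lemma prod_exp_entropy (I : finType) (p : I -> R) (e : I -> nat) (c : R) :
  (forall i, 0 <= p i) -> (forall i, (e i)%:R = c * p i) ->
  \prod_i p i ^+ e i = expR (- (c * ln 2 * entropy p)).
Proof.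
move=> p0 ec; rewrite /entropy.
have -> : - (c * ln 2 * (- \sum_i p i * (ln (p i) / ln 2))) = \sum_i (e i)%:R * ln (p i).
  rewrite !mulrN opprK mulr_sumr; apply: eq_bigr => i _.
  rewrite ec; field; exact: lt0r_neq0 ln2_gt0.
rewrite expR_sum; apply: eq_bigr => i _.
have [pi0|pi0] := eqVneq (p i) 0.
  have := ec i; rewrite pi0 mulr0 => /eqP; rewrite pnatr_eq0 => /eqP ->.
  by rewrite expr0 mul0r expR0.
by rewrite expRM_natl lnK// posrE lt_neqAle eq_sym pi0 p0.
Qed.

(** With y = sqrt x one has |x ln x| = 2 y^2 ln(1/y), and ln(1/y) < 1/y; this majorant gives
    continuity at 0. *)
Lemma norm_xlnx_le x : `|x| < 1 -> `|x * ln x| <= 2 * Num.sqrt `|x|.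
Proof.
have [x0 _|x0 x1] := leP x 0; first by rewrite ln0// mulr0 normr0 mulr_ge0// sqrtr_ge0.
rewrite (ger0_norm (ltW x0)) in x1 *.
set y := Num.sqrt x.
have y0 : 0 < y by rewrite sqrtr_gt0.
have xE : x = y * y by rewrite -expr2 sqr_sqrtr// ltW.
rewrite normrM (ger0_norm (ltW x0)) ltr0_norm ?ln_lt0 ?x0//.
have lnx : - ln x = 2 * ln y^-1 by rewrite xE lnM ?posrE// lnV ?posrE//; ring.
rewrite lnx xE; have := @ln_sublinear _ y^-1; rewrite invr_gt0 => /(_ y0) h.
have : y * y * ln y^-1 <= y * y * y^-1 by rewrite ler_pM2l ?mulr_gt0// ltW.
by rewrite mulfK ?gt_eqF// => ?; lra.
Qed.

(** Because [ln] is 0 on nonpositive numbers, continuity holds on the whole line, so the entropies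
    below are continuous on all vectors and not only on the simplex. *)
Lemma xlnx_continuous : continuous (fun x : R => x * ln x).
Proof.
move=> x; have [x0|x0|->] := ltgtP x 0.
- apply: cvg_near_cst; rewrite (ln0 (ltW x0)) mulr0.
  near=> y; rewrite ln0 ?mulr0// ltW//; near: y; exact: lt_nbhsl.
- by apply: cvgM; [exact: cvg_id|exact: continuous_ln].
- rewrite /continuous_at mul0r; apply/norm_cvg0P.
  apply: (@squeeze_cvgr _ (nbhs (0:R)) _ R (fun=> 0) (fun x => 2 * Num.sqrt `|x|)).
  + apply: (filterS _ (@cvgr0_norm_lt _ _ _ (nbhs (0:R)) _ id cvg_id 1 ltr01)).
    by move=> y y1; rewrite normr_ge0 norm_xlnx_le.
  + exact: cvg_cst.
  + have h : (Num.sqrt `|x0| @[x0 --> (0 : R)] --> Num.sqrt `|0 : R|)%classic.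
      apply: (@continuous_comp _ _ _ (fun x : R => `|x|) (@Num.sqrt R)).
        exact: norm_continuous.
      exact: sqrt_continuous.
    have := cvgM (cvg_cst (2 : R)) h.
    by rewrite normr0 sqrtr0 mulr0; apply.
Unshelve. all: by end_near.
Qed.

Lemma poly_le_exp (k : nat) (d : R) : 0 < d ->
  exists N0, forall N, (N0 <= N)%N -> (N.+1)%:R ^+ k <= expR (N%:R * d).
Proof.
move=> d0; pose M : R := 2 ^+ k * (k.+1)`!%:R / d ^+ k.+1.
(* For N >= M the term (N d)^(k+1) / (k+1)! of the exponential series already exceeds 2^k N^k, which
   is at least (N+1)^k. *)
exists (Num.truncn M).+1 => N hN.
have MN : M <= N%:R.
  by apply/ltW/(lt_le_trans (truncnS_gt M)); rewrite ler_nat.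
have N0 : (0 < N)%N by apply: leq_trans hN.
have Nd : 0 <= N%:R * d by rewrite mulr_ge0// ltW.
apply: le_trans (expR_ge1Dxn k Nd).
apply: (@le_trans _ _ (2 ^+ k * N%:R ^+ k)).
  rewrite -exprMn; apply: lerXn2r; rewrite ?nnegrE ?mulr_ge0//.
  by rewrite -natrM ler_nat mul2n -addnn -addn1 leq_add2l.
apply: (@le_trans _ _ ((N%:R * d) ^+ k.+1 / (k.+1)`!%:R)); last by rewrite lerDr.
rewrite ler_pdivlMr ?ltr0n ?fact_gt0//.
move: MN; rewrite ler_pdivrMr ?exprn_gt0// => MN.
have -> : 2 ^+ k * N%:R ^+ k * (k.+1)`!%:R = N%:R ^+ k * (2 ^+ k * (k.+1)`!%:R) :> R.
  by ring.
have -> : (N%:R * d) ^+ k.+1 = N%:R ^+ k * (N%:R * d ^+ k.+1).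
  by rewrite exprMn exprS; ring.
by rewrite ler_wpM2l// exprn_ge0.
Qed.

Lemma lim_root_le (u : nat -> R) (k : nat) (c : R) :
  (forall N, 0 <= u N) ->
  (forall N, (0 < N)%N -> u N <= (N.+1)%:R ^+ k * expR (N%:R * c)) ->
  limn (fun N => u N `^ N%:R^-1) <= expR c.
Proof.
move=> u0 uP; set v := fun N => _.
(* If the roots do not converge, [limn] takes its default value 0, which satisfies the bound. *)
have [cv|ncv] := pselect (cvgn v); last first.
  rewrite /lim /= /lim_in xgetPN; last by move=> l hl; apply: ncv; apply/cvg_ex; exists l.
  exact: expR_ge0.
apply/ler_addgt0Pr => e e0.
(* Chosen so that expR (c + d) = expR c + e: the polynomial factor is absorbed by expR (N d). *)
pose d := ln (expR c + e) - c.
have ce : 0 < expR c + e by rewrite addr_gt0// expR_gt0.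
have d0 : 0 < d by rewrite subr_gt0 -ltr_expR lnK ?posrE// ltrDl.
have [N0 hN0] := poly_le_exp k d0.
apply: limr_le => //; near=> N.
have N_gt0 : (0 < N)%N by near: N; exists 1%N.
rewrite /v.
have -> : expR c + e = (expR (N%:R * (c + d))) `^ N%:R^-1.
  rewrite -expRM mulrC mulKf ?pnatr_eq0 ?gtn_eqF// /d subrKC lnK//.
apply: ge0_ler_powR; rewrite ?invr_ge0 ?ler0n ?nnegrE ?expR_ge0//.
apply: le_trans (uP _ N_gt0) _; rewrite mulrDr addrC expRD ler_wpM2r ?expR_ge0//.
by apply: hN0; near: N; exists N0.
Unshelve. all: by end_near.
Qed.

End RealLemmas.

(** * Matrix multiplication tensors *)

Section Charts.
Variables (F : fieldType) (X Y Z : finType) (c : X -> Y -> Z -> F).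
Variables (A : {set X}) (B : {set Y}) (C : {set Z}).

(* The variables of a tensor equivalent to <n, m, p>, named by the entries of
   the three matrices. *)
Record mm_chart (n m p : nat) := MMChart {
  chX : 'I_n * 'I_m -> X;
  chY : 'I_m * 'I_p -> Y;
  chZ : 'I_p * 'I_n -> Z;
  chX_inj : injective chX;
  chY_inj : injective chY;
  chZ_inj : injective chZ;
  chX_im : forall x, (x \in A) = (x \in codom chX);
  chY_im : forall y, (y \in B) = (y \in codom chY);
  chZ_im : forall z, (z \in C) = (z \in codom chZ);
  chE : forall x y z, (c (chX x) (chY y) (chZ z) != 0) =
          [&& x.2 == y.1, y.2 == z.1 & z.2 == x.1] }.

Definition monomials : {set X * Y * Z} :=
  [set q | [&& q.1.1 \in A, q.1.2 \in B, q.2 \in C & c q.1.1 q.1.2 q.2 != 0]].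

Lemma mm_chartP v : mm_volume (subtensor c A B C) v ->
  exists n m p (ch : mm_chart n m p),
    [/\ (0 < n)%N, (0 < m)%N, (0 < p)%N & v = (n * m * p)%N].
Proof.
case=> n [m [p [n0 m0 p0 ->]]] [f [g [h [[f' fK f'K] [g' gK g'K] [h' hK h'K] E]]]].
have im (U V : finType) (D : {set U}) (a : V -> {x | x \in D})
    (b : {x | x \in D} -> V) : cancel b a ->
    forall x, (x \in D) = (x \in codom (fun w => val (a w))).
  move=> bK x; apply/idP/codomP => [xD|[w ->]]; last exact: valP.
  by exists (b (Sub x xD)); rewrite bK SubK.
exists n, m, p; unshelve eexists.
  apply: (@MMChart n m p (fun x => val (f' x)) (fun y => val (g' y)) (fun z => val (h' z))).
  - by move=> x y /val_inj; apply: can_inj f'K _ _.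
  - by move=> x y /val_inj; apply: can_inj g'K _ _.
  - by move=> x y /val_inj; apply: can_inj h'K _ _.
  - exact: im fK.
  - exact: im gK.
  - exact: im hK.
  - move=> x y z; have := E (f' x) (g' y) (h' z).
    rewrite f'K g'K h'K /= => <-.
    by case: [&& _, _ & _]; rewrite ?oner_eq0 ?eqxx.
by [].
Qed.

Section Chart.
Variables (n m p : nat) (ch : mm_chart n m p).

Lemma chart_monom i j k : (chX ch (i, j), chY ch (j, k), chZ ch (k, i)) \in monomials.
Proof.
by rewrite inE/= (chX_im ch) (chY_im ch) (chZ_im ch) !codom_f chE/= !eqxx.
Qed.

Lemma chart_monomP x y z : (x, y, z) \in monomials ->
  exists i j k, [/\ x = chX ch (i, j), y = chY ch (j, k) & z = chZ ch (k, i)].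
Proof.
rewrite inE/= (chX_im ch) (chY_im ch) (chZ_im ch).
case/and4P => /codomP[[i j] ->] /codomP[[j' k] ->] /codomP[[k' i'] ->].
by rewrite chE/= => /and3P[/eqP <- /eqP <- /eqP ->]; exists i, j, k.
Qed.

Lemma chart_sum (V : nmodType) (G : X * Y * Z -> V) :
  \sum_(q in monomials) G q =
  \sum_j \sum_k \sum_i G (chX ch (i, j), chY ch (j, k), chZ ch (k, i)).
Proof.
pose h (q : 'I_m * 'I_p * 'I_n) :=
  (chX ch (q.2, q.1.1), chY ch (q.1.1, q.1.2), chZ ch (q.1.2, q.2)).
have hinj : {in [set: 'I_m * 'I_p * 'I_n] &, injective h}.
  move=> [[j k] i] [[j' k'] i'] _ _ [] /(@chX_inj _ _ _ ch) [-> ->].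
  by move=> /(@chY_inj _ _ _ ch) [->].
have -> : monomials = h @: [set: 'I_m * 'I_p * 'I_n].
  apply/setP => -[[x y] z]; apply/idP/imsetP => [/chart_monomP[i [j [k [-> -> ->]]]]|].
    by exists (j, k, i).
  by case=> -[[j k] i] _ ->; apply: chart_monom.
rewrite (big_imset _ hinj)/= pair_big/= pair_big/=; apply: eq_big => [?|[[j k] i] _] //.
by rewrite inE.
Qed.

Lemma chart_card : #|monomials| = (n * m * p)%N.
Proof.
rewrite -sum1_card (chart_sum (V := nat)) !sum_nat_const !card_ord.
by rewrite muln1; ring.
Qed.

Lemma chart_cardX : #|A| = (n * m)%N.
Proof. by rewrite (eq_card (chX_im ch)) (card_codom (@chX_inj _ _ _ ch)) card_prod !card_ord. Qed.

Lemma chart_cardY : #|B| = (m * p)%N.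
Proof. by rewrite (eq_card (chY_im ch)) (card_codom (@chY_inj _ _ _ ch)) card_prod !card_ord. Qed.

Lemma chart_cardZ : #|C| = (p * n)%N.
Proof. by rewrite (eq_card (chZ_im ch)) (card_codom (@chZ_inj _ _ _ ch)) card_prod !card_ord. Qed.

End Chart.

(** Counting monomials describes the volume without reference to the formats chosen by [xget]. The
    last identity is (nmp)^2 = (nm)(mp)(pn). *)
Lemma Vol_subtensor : is_matmul (subtensor c A B C) ->
  [/\ Vol (subtensor c A B C) = #|monomials|, (0 < #|monomials|)%N &
      (#|monomials| ^ 2)%N = (#|A| * #|B| * #|C|)%N].
Proof.
move=> [v hv]; have : mm_volume (subtensor c A B C) (Vol (subtensor c A B C)).
  by rewrite /Vol; apply: xgetPex; exists v.
case/mm_chartP => n [m [p [ch [n0 m0 p0 ->]]]].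
rewrite (chart_card ch) (chart_cardX ch) (chart_cardY ch) (chart_cardZ ch).
split=> //; first by rewrite !muln_gt0 n0 m0 p0.
by rewrite expnS expn1; ring.
Qed.

End Charts.

(** The weight of a part is spread evenly over its variables. Only an inequality holds, since an
    empty part loses its weight. *)
Lemma sum_parts (R : realFieldType) (V L : finType) (part : V -> L) (U : {set L}) (W : {set V})
    (w : L -> R) : (forall l, 0 <= w l) -> (forall x, (x \in W) = (part x \in U)) ->
  \sum_(x in W) w (part x) / #|[set y | part y == part x]|%:R <= \sum_(l in U) w l.
Proof.
move=> w0 WU; rewrite (partition_big part (mem U)) => [|x]; last by rewrite WU.
apply: ler_sum => l lU.
rewrite (eq_bigr (fun=> w l / #|[set y | part y == l]|%:R)) => [|x /andP[_ /eqP <-]//].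
rewrite sumr_const (eq_card (B := [set y | part y == l])); last first.
  move=> x; rewrite [LHS]/((x \in W) && (part x == l)) WU inE.
  have {}lU : l \in U := lU.
  by have [->|_] := eqVneq (part x) l; [rewrite lU | case: ifP].
rewrite -[leLHS]mulr_natr -mulrA; have [->|n0] := eqVneq #|[set y | part y == l]| 0%N.
  by rewrite !mulr0.
by rewrite mulVf ?pnatr_eq0// mulr1.
Qed.

Lemma sqrtr_div_sqr (R : rcfType) (a : R) (b : nat) : 0 <= a ->
  Num.sqrt (a / b%:R ^+ 2) = Num.sqrt a / b%:R.
Proof.
by move=> a0; rewrite sqrtrM// sqrtrV ?exprn_ge0// sqrtr_sqr ger0_norm.
Qed.

(** * Monomials of constituents and a Loomis-Whitney inequality for annotations *)

Section PartCounts.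
Variables (F : fieldType) (I J K : finType) (T : ptensor F I J K).
Implicit Types (s : I * J * K) (S : {set I * J * K}).

Definition cardX i := #|[set x : varX T | partX x == i]|.
Definition cardY j := #|[set y : varY T | partY y == j]|.
Definition cardZ k := #|[set z : varZ T | partZ z == k]|.

Definition annot (q : varX T * varY T * varZ T) : I * J * K :=
  (partX q.1.1, partY q.1.2, partZ q.2).

Definition monom s : {set varX T * varY T * varZ T} :=
  [set q | (annot q == s) && (tcoef q.1.1 q.1.2 q.2 != 0)].

Definition monom_sum S : {set varX T * varY T * varZ T} :=
  [set q | (annot q \in S) && (tcoef q.1.1 q.1.2 q.2 != 0)].

Lemma suppE s : (s \in supp T) = (0 < #|monom s|)%N.
Proof.
rewrite inE; apply/existsP/card_gt0P => [[x /existsP[y /existsP[z]]]|[[[x y] z]]].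
  rewrite /blockcoef; case: ifP => [/eqP e h|_ /eqP//].
  by exists (x, y, z); rewrite inE /annot/= e eqxx.
rewrite inE => /andP[/eqP e h]; exists x; apply/existsP; exists y; apply/existsP.
by exists z; rewrite /blockcoef; rewrite /annot/= in e; rewrite e eqxx.
Qed.

Lemma monomials_constituent s :
  monomials (@blockcoef _ _ _ _ T s) [set x | partX x == s.1.1] [set y | partY y == s.1.2]
    [set z | partZ z == s.2] = monom s.
Proof.
case: s => [[i j] k].
apply/setP => -[[x y] z]; rewrite !inE /blockcoef /annot /= !xpair_eqE.
by do 3!case: eqP => //= _; rewrite ?eqxx.
Qed.

Lemma sum_blockcoef S (x : varX T) (y : varY T) (z : varZ T) :
  \sum_(s in S) blockcoef s x y z =
  if annot (x, y, z) \in S then tcoef x y z else 0.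
Proof.
rewrite /blockcoef -big_mkcondr/=.
rewrite (eq_bigl (fun s => (annot (x, y, z) \in S) && (s == annot (x, y, z)))).
  by case: ifP => h; rewrite ?big_pred1_eq// big_pred0.
move=> s; rewrite eq_sym /annot/=; case: eqP => [->|]; rewrite ?andbT ?andbF//.
Qed.

Lemma monomials_constituent_sum S :
  monomials (fun x y z => \sum_(s in S) @blockcoef _ _ _ _ T s x y z)
     (sumX T S) (sumY T S) (sumZ T S) = monom_sum S.
Proof.
apply/setP => -[[x y] z]; rewrite !inE sum_blockcoef.
case: ifP => h; rewrite ?eqxx ?andbF//=.
have -> : [exists s in S, partX x == s.1.1] by apply/exists_inP; exists (annot (x, y, z)).
have -> : [exists s in S, partY y == s.1.2] by apply/exists_inP; exists (annot (x, y, z)).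
by have -> : [exists s in S, partZ z == s.2] by apply/exists_inP; exists (annot (x, y, z)).
Qed.

Lemma sum_monom (V : nmodType) S (G : varX T * varY T * varZ T -> V) :
  \sum_(q in monom_sum S) G q = \sum_(s in S) \sum_(q in monom s) G q.
Proof.
rewrite (partition_big annot (mem S)) => [|q]; last by rewrite inE => /andP[].
apply: eq_bigr => s sS; apply: eq_bigl => q; rewrite !inE.
have {}sS : s \in S := sS.
by have [->|ne] := eqVneq (annot q) s; rewrite ?andbF// sS andbT.
Qed.

Lemma Vol_constituent s : is_matmul (constituent T s) ->
  [/\ Vol (constituent T s) = #|monom s|, (0 < #|monom s|)%N &
      (#|monom s| ^ 2)%N = (cardX s.1.1 * cardY s.1.2 * cardZ s.2)%N].
Proof. by move/Vol_subtensor; rewrite monomials_constituent. Qed.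

Lemma Vol_constituent_sum S : is_matmul (constituent_sum T S) ->
  Vol (constituent_sum T S) = (\sum_(s in S) #|monom s|)%N.
Proof.
move/Vol_subtensor; rewrite monomials_constituent_sum => -[-> _ _].
rewrite -sum1_card (sum_monom (V := nat)); apply: eq_bigr => s _.
by rewrite -sum1_card.
Qed.

Section LoomisWhitney.
Variables (R : rcfType) (S : {set I * J * K}).
Variables (wX : I -> R) (wY : J -> R) (wZ : K -> R).
Hypotheses (wX0 : forall i, 0 <= wX i) (wY0 : forall j, 0 <= wY j)
  (wZ0 : forall k, 0 <= wZ k).

(** The triangle inequality concerns variables, the weights concern parts. Spreading each weight
    evenly over its part and summing over the monomials of s gives back the weight of s, because the
    square of the number of monomials is the product of the sizes of the three parts. *)
Lemma chart_loomis_whitney :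
  is_matmul (constituent_sum T S) -> (forall s, s \in S -> (0 < #|monom s|)%N /\
     (#|monom s| ^ 2)%N = (cardX s.1.1 * cardY s.1.2 * cardZ s.2)%N) ->
  (\sum_(s in S) Num.sqrt (wX s.1.1 * wY s.1.2 * wZ s.2)) ^+ 2 <=
  (\sum_(i in [set s.1.1 | s in S]) wX i) * (\sum_(j in [set s.1.2 | s in S]) wY j) *
  (\sum_(k in [set s.2 | s in S]) wZ k).
Proof.
move=> [v /mm_chartP[n [m [p [ch _]]]]] hS.
pose aX (x : varX T) := wX (partX x) / (cardX (partX x))%:R.
pose aY (y : varY T) := wY (partY y) / (cardY (partY y))%:R.
pose aZ (z : varZ T) := wZ (partZ z) / (cardZ (partZ z))%:R.
have aX0 x : 0 <= aX x by rewrite divr_ge0.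
have aY0 x : 0 <= aY x by rewrite divr_ge0.
have aZ0 x : 0 <= aZ x by rewrite divr_ge0.
have -> : \sum_(s in S) Num.sqrt (wX s.1.1 * wY s.1.2 * wZ s.2) =
    \sum_(q in monom_sum S) Num.sqrt (aX q.1.1 * aY q.1.2 * aZ q.2).
  rewrite sum_monom; apply: eq_bigr => s /hS[m0 mE].
  rewrite (eq_bigr (fun=> Num.sqrt (wX s.1.1 * wY s.1.2 * wZ s.2) / #|monom s|%:R)).
    by rewrite sumr_const -[RHS]mulr_natr divfK// pnatr_eq0 -lt0n.
  case: s {m0} mE => -[i j] k/= mE [[x y] z]; rewrite inE /annot/aX/aY/aZ/= => /andP[/eqP [-> -> ->] _].
  rewrite !mulf_div -!natrM -mE natrX; apply: sqrtr_div_sqr.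
  by rewrite !mulr_ge0.
rewrite -monomials_constituent_sum (chart_sum ch)/=.
apply: le_trans (triangle_sqrt_sum (a := fun x => aX (chX ch x))
  (b := fun y => aY (chY ch y)) (c := fun z => aZ (chZ ch z)) _ _ _) _ => //.
have sumc (V L : finType) (q : V -> L) (W : {set L}) (a : L -> R) :
    injective q -> (forall x, (x \in W) = (x \in codom q)) ->
    \sum_x a (q x) = \sum_(x in W) a x.
  move=> qi Wq; rewrite (eq_bigl (mem (q @: setT))) => [|x].
    by rewrite (big_imset _ (in2W qi)); apply: eq_bigl => x /=; rewrite in_setT.
  rewrite -[LHS]/(x \in W) Wq; apply/codomP/imsetP => [[w ->]|[w _ ->]]; exists w; rewrite ?in_setT//.
rewrite (sumc _ _ _ _ _ (@chX_inj _ _ _ _ _ _ _ _ _ _ _ ch) (chX_im ch)).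
rewrite (sumc _ _ _ _ _ (@chY_inj _ _ _ _ _ _ _ _ _ _ _ ch) (chY_im ch)).
rewrite (sumc _ _ _ _ _ (@chZ_inj _ _ _ _ _ _ _ _ _ _ _ ch) (chZ_im ch)).
apply: ler_pM; rewrite ?mulr_ge0 ?sumr_ge0//; first apply: ler_pM; rewrite ?sumr_ge0//.
- apply: sum_parts => // x; rewrite inE; apply/exists_inP/imsetP => -[s sS].
    by move=> /eqP; exists s.
  by move=> /eqP; exists s.
- apply: sum_parts => // x; rewrite inE; apply/exists_inP/imsetP => -[s sS].
    by move=> /eqP; exists s.
  by move=> /eqP; exists s.
- apply: sum_parts => // x; rewrite inE; apply/exists_inP/imsetP => -[s sS].
    by move=> /eqP; exists s.
  by move=> /eqP; exists s.
Qed.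

End LoomisWhitney.
End PartCounts.

(** * Zero directions of a consistent sum *)

Section Directions.
Variable D : nat.
Local Notation L := 'I_D.+1.

(** By condition (1) of [cw_like], these are the indices of the parts with more than one
    variable. *)
Definition inner (i : L) : bool := (i != ord0) && (i != ord_max).

Section Relation.
Variables (X Y Z : Type) (M : X -> Y -> Z -> Prop).
Variables (pX : X -> L) (pY : Y -> L) (pZ : Z -> L).

(* What condition (3) of cw_like says about the blocks over the part 0 of Z. *)
Definition matching : Prop :=
  [/\ forall x x' y z, M x y z -> M x' y z -> pZ z = ord0 -> pX x = pX x' -> x = x',
      forall x y y' z, M x y z -> M x y' z -> pZ z = ord0 -> pY y = pY y' -> y = y',
      forall x y z, M x y z -> pZ z = ord0 -> inner (pX x) = inner (pY y) &
      forall x y z, M x y z -> pZ z = ord0 -> inner (pX x) ->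
        exists x' y', [/\ M x' y' z, pX x' = pX x, pY y' = pY y, x' <> x & y' <> y]].

Definition one_nonzero (a b c : L) : bool :=
  [|| [&& a != ord0, b == ord0 & c == ord0], [&& a == ord0, b != ord0 & c == ord0] |
      [&& a == ord0, b == ord0 & c != ord0]].

Section Grid.
Variables (I J K : Type) (f : I -> J -> X) (g : J -> K -> Y) (h : K -> I -> Z).

(* Changing variables inside their parts while keeping the z-variable (k, i)
   stays in the grid, so only the middle index j moves. *)
Definition exchange : Prop := forall i j k x y,
  M x y (h k i) -> pX x = pX (f i j) -> pY y = pY (g j k) ->
  exists j', f i j' = x /\ g j' k = y.

End Grid.
End Relation.

(** The part of [cw_like] that concerns matrix multiplication constituents, in a form stable under
    cyclic rotation, so that each argument is made for one position only. The guard 0 < D is there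
    because [ord0] and [ord_max] coincide for D = 0. *)
Definition cw_rel (X Y Z : Type) (M : X -> Y -> Z -> Prop)
    (pX : X -> L) (pY : Y -> L) (pZ : Z -> L) : Prop :=
  [/\ forall x y z, M x y z -> [\/ pX x = ord0, pY y = ord0 | pZ z = ord0],
      [/\ forall x x', pX x = ord0 -> pX x' = ord0 -> x = x',
          forall y y', pY y = ord0 -> pY y' = ord0 -> y = y' &
          forall z z', pZ z = ord0 -> pZ z' = ord0 -> z = z'],
      [/\ matching M pX pY pZ,
          matching (fun y z x => M x y z) pY pZ pX &
          matching (fun z x y => M x y z) pZ pX pY] &
      forall x y z, M x y z -> ~~ inner (pX x) -> ~~ inner (pY y) -> ~~ inner (pZ z) ->
        (0 < D)%N -> one_nonzero (pX x) (pY y) (pZ z)].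

(** What a single coordinate retains of a chart of S^(0): values may repeat at that coordinate, but
    a change of variables within their parts is still realized by a move in the grid. *)
Definition grid (X Y Z : Type) (M : X -> Y -> Z -> Prop)
    (pX : X -> L) (pY : Y -> L) (pZ : Z -> L) (I J K : Type)
    (f : I -> J -> X) (g : J -> K -> Y) (h : K -> I -> Z) : Prop :=
  (forall i j k, M (f i j) (g j k) (h k i)) /\
  [/\ exchange M pX pY f g h, exchange (fun y z x => M x y z) pY pZ g h f &
      exchange (fun z x y => M x y z) pZ pX h f g].

Lemma cw_rel_rot X Y Z (M : X -> Y -> Z -> Prop) pX pY pZ :
  cw_rel M pX pY pZ -> cw_rel (fun y z x => M x y z) pY pZ pX.
Proof.
case=> r0 [u1 u2 u3] [m1 m2 m3] r1; split=> //.
  by move=> y z x /r0[h|h|h]; [apply: Or33|apply: Or31|apply: Or32].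
move=> y z x /r1 h bY bz bx D0; move: (h bx bY bz D0).
by rewrite /one_nonzero => /or3P[] /and3P[-> -> ->]; rewrite ?orbT.
Qed.

Lemma grid_rot X Y Z (M : X -> Y -> Z -> Prop) pX pY pZ I J K
    (f : I -> J -> X) (g : J -> K -> Y) (h : K -> I -> Z) :
  grid M pX pY pZ f g h -> grid (fun y z x => M x y z) pY pZ pX g h f.
Proof. by case=> hM [e1 e2 e3]; split. Qed.

Lemma inner_neq0 i : inner i -> i <> ord0.
Proof. by case/andP => /eqP. Qed.

Section GridLemmas.
Variables (X Y Z : Type) (M : X -> Y -> Z -> Prop).
Variables (pX : X -> L) (pY : Y -> L) (pZ : Z -> L).
Variables (I J K : Type) (f : I -> J -> X) (g : J -> K -> Y) (h : K -> I -> Z).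
Hypotheses (hM : cw_rel M pX pY pZ) (hG : grid M pX pY pZ f g h).

(** The x-part has a second variable, and the exchange property finds it at some (i, j'). If another
    z-entry (k2, i) were nonzero, the y-entries at (j, k2) and (j', k2) would both be the single
    variable of part 0; the matching over that part would then force f i j = f i j'. So row i of z
    vanishes, and likewise column k. The neighbours of a general entry (k2, i2) are therefore inner,
    which leaves only z to be zero. *)
Lemma grid_inner_zero i j k : inner (pX (f i j)) -> pZ (h k i) = ord0 ->
  forall k' i', pZ (h k' i') = ord0.
Proof.
case: hM => r0 [uX uY _] [[_ _ zB zS] [xX _ _ _] [_ yY _ _]] _.
case: hG => G [ex _ _] bx z0.
have bY : inner (pY (g j k)) by rewrite -(zB _ _ _ (G i j k) z0).
have [x' [y' [Mxy px py nx ny]]] := zS _ _ _ (G i j k) z0 bx.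
have [j' [fj gj]] := ex _ _ _ _ _ Mxy px py.
have rowi k2 : pZ (h k2 i) = ord0.
  case: (r0 _ _ _ (G i j k2)) => [/(inner_neq0 bx)//|y0|//].
  have bx' : inner (pX (f i j')) by rewrite fj px.
  case: (r0 _ _ _ (G i j' k2)) => [/(inner_neq0 bx')//|y0'|//].
  have gE := uY _ _ y0 y0'; case: nx; rewrite -fj; apply/esym.
  apply: (yY (h k2 i) _ _ (g j k2)) => //; last by rewrite fj px.
  by rewrite gE.
have colk i2 : pZ (h k i2) = ord0.
  case: (r0 _ _ _ (G i2 j k)) => [x0|/(inner_neq0 bY)//|//].
  have by' : inner (pY (g j' k)) by rewrite gj py.
  case: (r0 _ _ _ (G i2 j' k)) => [x0'|/(inner_neq0 by')//|//].
  have fE := uX _ _ x0 x0'; case: ny; rewrite -gj; apply/esym.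
  apply: (xX _ _ (h k i2) (f i2 j)) => //; last by rewrite gj py.
  by rewrite fE.
move=> k2 i2; have b1 : inner (pY (g j k2)).
  by rewrite -(zB _ _ _ (G i j k2) (rowi k2)).
have b2 : inner (pX (f i2 j)) by rewrite (zB _ _ _ (G i2 j k) (colk i2)).
by case: (r0 _ _ _ (G i2 j k2)) => [/(inner_neq0 b2)|/(inner_neq0 b1)|].
Qed.

End GridLemmas.

Lemma grid_inner_direction X Y Z (M : X -> Y -> Z -> Prop) pX pY pZ I J K
    (f : I -> J -> X) (g : J -> K -> Y) (h : K -> I -> Z) i j (k : K) :
  cw_rel M pX pY pZ -> grid M pX pY pZ f g h -> inner (pX (f i j)) ->
  (forall j k, pY (g j k) = ord0) \/ (forall k i, pZ (h k i) = ord0).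
Proof.
move=> hM hG bx; have [r0 _ [_ _ [_ _ yB _]] _] := hM; have [G _] := hG.
case: (r0 _ _ _ (G i j k)) => [/(inner_neq0 bx)//|y0|z0]; last first.
  by right; apply: grid_inner_zero hM hG _ _ _ bx z0.
(* Over the part 0 of Y the x- and z-indices are matched, so the z-index is inner too: this is
   [grid_inner_zero] after two rotations. *)
left; have bz : inner (pZ (h k i)) by rewrite (yB _ _ _ (G i j k) y0).
exact: (grid_inner_zero (cw_rel_rot (cw_rel_rot hM)) (grid_rot (grid_rot hG)) bz y0).
Qed.

(** An inner index settles the matter by [grid_inner_direction]. Without inner indices and with D >
    0, every triple of the grid has exactly one nonzero index; a nonzero x-entry at (i, j) and a
    nonzero y-entry at (j', k') then determine, triple by triple, that all z-entries vanish. *)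
Lemma grid_direction X Y Z (M : X -> Y -> Z -> Prop) pX pY pZ I J K
    (f : I -> J -> X) (g : J -> K -> Y) (h : K -> I -> Z) (i0 : I) (j0 : J) (k0 : K) :
  cw_rel M pX pY pZ -> grid M pX pY pZ f g h ->
  [\/ forall i j, pX (f i j) = ord0, forall j k, pY (g j k) = ord0 |
      forall k i, pZ (h k i) = ord0].
Proof.
move=> hM hG.
have [[i [j b]]|nbX] := pselect (exists i j, inner (pX (f i j))).
  by case: (grid_inner_direction k0 hM hG b); [apply: Or32|apply: Or33].
have [[j [k b]]|nbY] := pselect (exists j k, inner (pY (g j k))).
  case: (grid_inner_direction i0 (cw_rel_rot hM) (grid_rot hG) b);
    [exact: Or33|exact: Or31].
have [[k [i b]]|nbZ] := pselect (exists k i, inner (pZ (h k i))).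
  case: (grid_inner_direction j0 (cw_rel_rot (cw_rel_rot hM)) (grid_rot (grid_rot hG)) b);
    [exact: Or31|exact: Or32].
have [D0|D0] := posnP D.
  apply: Or31 => i j; apply: val_inj => /=.
  by apply/eqP; rewrite -leqn0 -[X in (_ <= X)%N]D0 -ltnS ltn_ord.
have [_ _ _ r1] := hM; have [G _] := hG.
have one i j k : one_nonzero (pX (f i j)) (pY (g j k)) (pZ (h k i)).
  apply: r1 => //; apply/negP => b; [apply: nbX|apply: nbY|apply: nbZ].
  - by exists i, j.
  - by exists j, k.
  - by exists k, i.
have [fx|/existsNP[i /existsNP[j /eqP fij]]] := pselect (forall i j, pX (f i j) = ord0).
  exact: Or31.
have [gx|/existsNP[j' /existsNP[k' /eqP gjk]]] := pselect (forall j k, pY (g j k) = ord0).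
  exact: Or32.
apply: Or33 => k i'.
have z1 : pZ (h k' i') == ord0.
  by move: gjk (one i' j' k'); rewrite /one_nonzero; do 3!case: (_ == ord0).
have y1 : pY (g j k') == ord0.
  by move: fij (one i j k'); rewrite /one_nonzero; do 3!case: (_ == ord0).
have x1 : pX (f i' j) != ord0.
  by move: z1 y1 (one i' j k'); rewrite /one_nonzero; do 3!case: (_ == ord0).
by apply/eqP; move: x1 (one i' j k); rewrite /one_nonzero; do 3!case: (_ == ord0).
Qed.

End Directions.

(** * Diagonal blocks of the form in condition (3) *)

Section Diagonal.
Variable F : fieldType.

Lemma tequiv_trans (T U V : tensor F) : tequiv T U -> tequiv U V -> tequiv T V.
Proof.
move=> [f [g [h [bf bg bh E]]]] [f' [g' [h' [bf' bg' bh' E']]]].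
exists (f' \o f), (g' \o g), (h' \o h); split; try exact: bij_comp.
by move=> x y z /=; rewrite E' E.
Qed.

Lemma tequiv_rot (T U : tensor F) : tequiv T U -> tequiv (trot T) (trot U).
Proof.
move=> [f [g [h [bf bg bh E]]]]; exists g, h, f; split=> // y z x; exact: E.
Qed.

Definition diagonal (m : nat) : tensor F :=
  Tensor 'I_m 'I_m unit (fun i j _ => (i == j)%:R).

Section Subtensor.
Variables (X Y Z : finType) (c : X -> Y -> Z -> F) (A : {set X}) (B : {set Y}) (C : {set Z}).
Variable m : nat.
Hypothesis hd : tequiv (subtensor c A B C) (diagonal m).

Lemma diagonal_card : #|A| = #|B|.
Proof.
have [f [g [h [bf bg bh E]]]] := hd.
have sub (V : finType) (W : {set V}) : #|{: {x : V | x \in W}}| = #|W| by rewrite card_sig.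
by rewrite -!sub (bij_eq_card bf) (bij_eq_card bg).
Qed.

Lemma diagonal_coef x y z (xA : x \in A) (yB : y \in B) (zC : z \in C) :
  exists (f : {x | x \in A} -> 'I_m) (g : {y | y \in B} -> 'I_m),
  [/\ bijective f, bijective g &
      forall x y (xA : x \in A) (yB : y \in B),
        (c x y z != 0) = (f (Sub x xA) == g (Sub y yB))].
Proof.
have [f [g [h [bf bg bh E]]]] := hd; exists f, g; split=> // x1 y1 xA1 yB1.
rewrite -[c x1 y1 z]/(c (val (Sub x1 xA1 : {x | x \in A}))
  (val (Sub y1 yB1 : {y | y \in B})) (val (Sub z zC : {z | z \in C}))).
rewrite -[c _ _ _]/(tcoef (t := subtensor c A B C) _ _ _) -E /=.
by case: (f _ == g _); rewrite ?oner_eq0 ?eqxx.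
Qed.

Lemma diagonal_injl x x' y z : x \in A -> x' \in A -> y \in B -> z \in C ->
  c x y z != 0 -> c x' y z != 0 -> x = x'.
Proof.
move=> xA xA' yB zC; have [f [g [bf bg E]]] := diagonal_coef xA yB zC.
rewrite (E _ _ xA yB) (E _ _ xA' yB) => /eqP e /eqP e'.
by have /(bij_inj bf) [] : f (Sub x xA) = f (Sub x' xA') by rewrite e e'.
Qed.

Lemma diagonal_injr x y y' z : x \in A -> y \in B -> y' \in B -> z \in C ->
  c x y z != 0 -> c x y' z != 0 -> y = y'.
Proof.
move=> xA yB yB' zC; have [f [g [bf bg E]]] := diagonal_coef xA yB zC.
rewrite (E _ _ xA yB) (E _ _ xA yB') => /eqP e /eqP e'.
by have /(bij_inj bg) [] : g (Sub y yB) = g (Sub y' yB') by rewrite -e e'.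
Qed.

Lemma diagonal_total x x' y z : x \in A -> x' \in A -> y \in B -> z \in C ->
  exists2 y', y' \in B & c x' y' z != 0.
Proof.
move=> xA xA' yB zC; have [f [g [bf [g' gK g'K] E]]] := diagonal_coef xA yB zC.
pose u : {y | y \in B} := g' (f (Sub x' xA')).
exists (val u); first exact: valP.
rewrite (E _ _ xA' (valP u)).
by have -> : Sub (val u) (valP u) = u; [exact: val_inj | rewrite g'K].
Qed.

End Subtensor.

Lemma is_matmul_diagonal (m : nat) : (0 < m)%N ->
  [/\ is_matmul (Tensor 'I_m 'I_m unit (fun i j _ => (i == j)%:R : F)),
      is_matmul (Tensor 'I_m unit 'I_m (fun i _ k => (i == k)%:R : F)) &
      is_matmul (Tensor unit 'I_m 'I_m (fun _ j k => (j == k)%:R : F))].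
Proof.
move=> m0.
have b1 (a : 'I_1) : a = ord0 by apply: val_inj; case: a => -[].
have bl : bijective (fun i : 'I_m => (i, ord0 : 'I_1)).
  by exists fst => // -[i j]; rewrite (b1 j).
have br : bijective (fun i : 'I_m => (ord0 : 'I_1, i)).
  by exists snd => // -[i j]; rewrite (b1 i).
have bu : bijective (fun _ : unit => (ord0 : 'I_1, ord0 : 'I_1)).
  by exists (fun=> tt) => [[]|[i j]]//; rewrite (b1 i) (b1 j).
split; eexists.
- exists 1%N, m, 1%N; split=> //; exists (fun i => (ord0, i)), (fun i => (i, ord0)), (fun=> (ord0, ord0)).
  by split=> // x y z /=; rewrite ?eqxx ?andbT.
- exists m, 1%N, 1%N; split=> //; exists (fun i => (i, ord0)), (fun=> (ord0, ord0)), (fun i => (ord0, i)).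
  by split=> // x y z /=; rewrite ?eqxx /= eq_sym.
- exists 1%N, 1%N, m; split=> //; exists (fun=> (ord0, ord0)), (fun i => (ord0, i)), (fun i => (i, ord0)).
  by split=> // x y z /=; rewrite ?eqxx /= ?andbT.
Qed.

Lemma is_matmul_equiv (T U : tensor F) : tequiv T U -> is_matmul U -> is_matmul T.
Proof.
move=> TU [v [n [m [p [n0 m0 p0 vE UM]]]]]; exists v, n, m, p; split=> //.
exact: tequiv_trans UM.
Qed.

End Diagonal.

Section Matching.
Variables (F : fieldType) (D : nat) (X Y Z : finType) (c : X -> Y -> Z -> F).
Local Notation L := 'I_D.+1.
Variables (pX : X -> L) (pY : Y -> L) (pZ : Z -> L) (w : L -> L -> L -> bool).

Definition rel_of (x : X) (y : Y) (z : Z) : Prop :=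
  (c x y z != 0) && w (pX x) (pY y) (pZ z).

(** [c'] plays the role of the block coefficients, which are cut off outside the block of a, b and
    0. Coefficients and index filter are arbitrary so that the three cyclic positions are
    instances. *)
Lemma matching_diagonal (c' : L -> L -> X -> Y -> Z -> F) :
  (forall a b x y z, pX x = a -> pY y = b -> pZ z = ord0 -> c' a b x y z = c x y z) ->
  (forall a b, w a b ord0 -> exists m, tequiv
    (subtensor (c' a b) [set x | pX x == a] [set y | pY y == b] [set z | pZ z == ord0])
    (diagonal F m)) ->
  (forall i, (1 < #|[set x | pX x == i]|)%N = inner i) ->
  (forall i, (1 < #|[set y | pY y == i]|)%N = inner i) ->
  matching rel_of pX pY pZ.
Proof.
move=> cE dg cX cY; rewrite /rel_of; split.
- move=> x x' y z /andP[n0 wxy] /andP[n0' _] z0 exx'.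
  have [m hd] := dg (pX x) (pY y) (etrans (congr1 _ (esym z0)) wxy).
  apply: (diagonal_injl hd (y := y) (z := z)); rewrite ?inE ?exx' ?z0 ?eqxx ?cE//.
- move=> x y y' z /andP[n0 wxy] /andP[n0' _] z0 eyy'.
  have [m hd] := dg (pX x) (pY y) (etrans (congr1 _ (esym z0)) wxy).
  apply: (diagonal_injr hd (x := x) (z := z)); rewrite ?inE ?eyy' ?z0 ?eqxx ?cE//.
- move=> x y z /andP[n0 wxy] z0.
  have [m hd] := dg (pX x) (pY y) (etrans (congr1 _ (esym z0)) wxy).
  by rewrite -cX -cY (diagonal_card hd).
- move=> x y z /andP[n0 wxy] z0 bx.
  have [m hd] := dg (pX x) (pY y) (etrans (congr1 _ (esym z0)) wxy).
  have xA : x \in [set x1 | pX x1 == pX x] by rewrite inE.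
  have yB : y \in [set y1 | pY y1 == pY y] by rewrite inE.
  have zC : z \in [set z1 | pZ z1 == ord0] by rewrite inE z0.
  have : (1 < #|[set x1 | pX x1 == pX x]|)%N by rewrite cX.
  rewrite (cardsD1 x) xA ltnS card_gt0 => /set0Pn[x'].
  rewrite in_setD1 => /andP[nx xA'].
  have [y' yB' n0'] := diagonal_total hd xA xA' yB zC.
  have [exx eyy] : pX x' = pX x /\ pY y' = pY y.
    by move: xA' yB'; rewrite !inE => /eqP -> /eqP ->.
  exists x', y'; split=> //; last 2 first.
  + exact/eqP.
  + move=> yy'; rewrite yy' in n0'; move/eqP: nx; apply.
    by apply: (diagonal_injl hd xA' xA yB zC n0'); rewrite cE.
  + by rewrite exx eyy wxy andbT -(cE (pX x) (pY y)).
Qed.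

End Matching.

(** * Matrix multiplication constituents of a Coppersmith-Winograd-like tensor *)

Section CW.
Variables (F : fieldType) (D : nat) (T : ptensor F 'I_D.+1 'I_D.+1 'I_D.+1).
Hypothesis hCW : cw_like T.
Local Notation L := 'I_D.+1.
Implicit Types (a b d : L).

Lemma cw_card : [/\ forall i, (1 < cardX T i)%N = inner i,
  forall i, (1 < cardY T i)%N = inner i & forall i, (1 < cardZ T i)%N = inner i].
Proof.
have [[[x0 y0 z0] [[xD yD zD] h]] _ _ _] := hCW.
have case_i (i : L) : [\/ i = ord0, i = ord_max | (0 < i < D)%N /\ inner i].
  have [->|i0] := eqVneq i ord0; first exact: Or31.
  have [->|iD] := eqVneq i ord_max; first exact: Or32.
  apply: Or33; rewrite /inner i0 iD; split=> //.
  rewrite lt0n -(inj_eq val_inj) /= in i0 *; rewrite i0 ltn_neqAle -ltnS ltn_ord andbT.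
  by rewrite -(inj_eq val_inj) in iD.
by split=> i; case: (case_i i) => [->|->|[ilt ->]];
  rewrite /inner ?eqxx ?andbF//= /cardX/cardY/cardZ ?x0 ?y0 ?z0 ?xD ?yD ?zD//;
  case: (h _ ilt).
Qed.

(** Condition (2) excludes annotations without zero. Conversely, condition (3) makes the constituent
    a format <1,m,1>, <m,1,1> or <1,1,m>, and m > 0 because a constituent in the support has a
    monomial. *)
Lemma supp0_zero a b d : ((a, b, d) \in supp0 T) =
  ((a, b, d) \in supp T) && [|| a == ord0, b == ord0 | d == ord0].
Proof.
have [_ h2 h3 _] := hCW; rewrite inE; case: (boolP (_ \in supp T)) => //= sT.
apply/asboolP/or3P => [mm|].
  have [a0|a0] := eqVneq a ord0; first exact: Or31.
  have [b0|b0] := eqVneq b ord0; first exact: Or32.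
  have [d0|d0] := eqVneq d ord0; first exact: Or33.
  by case: (h2 _ _ _ sT a0 b0 d0).
have nz : exists q, q \in monom T (a, b, d) by apply/card_gt0P; rewrite -suppE.
case: nz => -[[x y] z]; rewrite inE /annot/= => /andP[/eqP e _].
have px : x \in [set x | partX x == (a, b, d).1.1] by rewrite inE; case: e => -> _ _ /=.
have py : y \in [set x | partY x == (a, b, d).1.2] by rewrite inE; case: e => _ -> _ /=.
have gt0 m (i : 'I_m) : (0 < m)%N by apply: leq_trans (ltn_ord i).
case=> /eqP e0; subst.
- have [_ _ /(_ sT)[m hd]] := h3 b d; apply: (is_matmul_equiv hd).
  have [f [g _]] := hd; have [_ _ //] := @is_matmul_diagonal F m (gt0 _ (g (Sub y py))).
- have [_ /(_ sT)[m hd] _] := h3 a d; apply: (is_matmul_equiv hd).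
  have [f _] := hd; have [_ //] := @is_matmul_diagonal F m (gt0 _ (f (Sub x px))).
- have [/(_ sT)[m hd] _ _] := h3 a b; apply: (is_matmul_equiv hd).
  have [f _] := hd; have [//] := @is_matmul_diagonal F m (gt0 _ (f (Sub x px))).
Qed.

Definition cw_monom (x : varX T) (y : varY T) (z : varZ T) : Prop :=
  (tcoef x y z != 0) && ((partX x, partY y, partZ z) \in supp0 T).

Lemma card_one_inj (V : finType) (A : {set V}) : #|A| = 1%N ->
  forall x y, x \in A -> y \in A -> x = y.
Proof. by move=> /eqP/cards1P[v ->] x y; rewrite !inE => /eqP -> /eqP ->. Qed.

Lemma cw_like_rel : cw_rel cw_monom (@partX _ _ _ _ T) (@partY _ _ _ _ T) (@partZ _ _ _ _ T).
Proof.
have [[[x0 y0 z0] _] _ h3 h4] := hCW; have [cX cY cZ] := cw_card.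
have sub0 a b d : (a, b, d) \in supp0 T -> (a, b, d) \in supp T by rewrite inE => /andP[].
split.
- move=> x y z /andP[_]; rewrite supp0_zero => /andP[_ /or3P[]/eqP];
    [exact: Or31|exact: Or32|exact: Or33].
- split=> x x' h h'.
  + by apply: (card_one_inj x0); rewrite inE ?h ?h'.
  + by apply: (card_one_inj y0); rewrite inE ?h ?h'.
  + by apply: (card_one_inj z0); rewrite inE ?h ?h'.
- split.
  + apply: (@matching_diagonal F D _ _ _ (@tcoef _ T) _ _ _ (fun a b d => (a, b, d) \in supp0 T)
      (fun a b x y z => blockcoef (a, b, ord0) x y z)) => //.
      by move=> a b x y z h1 h2 h3'; rewrite /blockcoef h1 h2 h3' eqxx.
    by move=> a b /sub0 sT; have [/(_ sT)] := h3 a b.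
  + apply: (@matching_diagonal F D _ _ _ (fun y z x => @tcoef _ T x y z) _ _ _
      (fun b d a => (a, b, d) \in supp0 T)
      (fun b d y z x => blockcoef (ord0, b, d) x y z)) => //.
      by move=> a b x y z h1 h2 h3'; rewrite /blockcoef h1 h2 h3' eqxx.
    move=> a b /sub0 sT; have [_ _ /(_ sT)[m hd]] := h3 a b; exists m.
    exact: (tequiv_rot hd).
  + apply: (@matching_diagonal F D _ _ _ (fun z x y => @tcoef _ T x y z) _ _ _
      (fun d a b => (a, b, d) \in supp0 T)
      (fun d a z x y => blockcoef (a, ord0, d) x y z)) => //.
      by move=> a b x y z h1 h2 h3'; rewrite /blockcoef h1 h2 h3' eqxx.
    move=> a b /sub0 sT; have [_ /(_ sT)[m hd] _] := h3 b a; exists m.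
    (* Two rotations list z before x, so the diagonal condition appears with its sides exchanged. *)
    have h := tequiv_rot (tequiv_rot hd); apply: tequiv_trans h _.
    exists id, id, id; split; try exact: (Bijective (g := id)).
    by move=> x y z /=; rewrite eq_sym.
- move=> x y z /andP[_ /sub0 sT] nx ny nz D0.
  have mem0D (i : L) : ~~ inner i -> i \in [:: ord0; ord_max].
    by rewrite /inner negb_and !negbK !inE.
  have := h4 _ _ _ (mem0D _ nx) (mem0D _ ny) (mem0D _ nz); rewrite sT => /esym.
  have Dn : ord_max != ord0 :> L by rewrite -(inj_eq val_inj) /= -lt0n.
  by rewrite /one_nonzero !inE => /or3P[] /eqP [-> -> ->]; rewrite !eqxx Dn ?orbT.
Qed.

End CW.

Section Rotation.
Variables (F : fieldType) (I : finType) (T : ptensor F I I I).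

Lemma supp_rot i j k : symmetric_ptensor T ->
  (i, j, k) \in supp T -> (j, k, i) \in supp T.
Proof.
move=> hs sT; have [f [g [h [_ _ _ E]]]] := hs _ _ _ sT.
move: sT; rewrite inE => /existsP[x /existsP[y /existsP[z]]].
rewrite {1}/blockcoef; case: ifP => [/eqP [xi yj zk] nz|_ /eqP//].
have px : x \in [set x | partX x == (i, j, k).1.1] by rewrite inE xi.
have py : y \in [set y | partY y == (i, j, k).1.2] by rewrite inE yj.
have pz : z \in [set z | partZ z == (i, j, k).2] by rewrite inE zk.
have := E (Sub y py) (Sub z pz) (Sub x px); rewrite /= {2}/blockcoef xi yj zk eqxx => e.
rewrite inE; apply/existsP; exists (val (f (Sub y py))); apply/existsP.
exists (val (g (Sub z pz))); apply/existsP; exists (val (h (Sub x px))).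
by rewrite [blockcoef _ _ _ _]e.
Qed.

End Rotation.

(** * Tensor powers *)

Lemma card_ffun_forall (E V : finType) (P : E -> pred V) :
  #|[set x : {ffun E -> V} | [forall t, P t (x t)]]| = (\prod_t #|[set v | P t v]|)%N.
Proof.
under eq_bigr => t _ do rewrite -sum1_card big_mkcond/=.
rewrite bigA_distr_bigA -sum1_card [LHS]big_mkcond/=; apply: eq_bigr => x _.
rewrite inE; case: (boolP [forall t, _]) => [/forallP h|].
  by rewrite big1// => t _; rewrite inE h.
rewrite negb_forall => /existsP[t /negbTE ht].
by rewrite (bigD1 t)//= inE ht.
Qed.

Lemma prod_sig (A : finType) (P : pred A) (G : A -> nat) :
  (\prod_(t | P t) G t = \prod_(e : {t : A | P t}) G (val e))%N.
Proof.
rewrite (reindex_omap (val : {t : A | P t} -> A) insub) => [|i Pi]; last by rewrite insubT.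
by apply: eq_bigl => -[i Pi] /=; rewrite insubT Pi /= eqxx.
Qed.

Section Powers.
Variables (F : fieldType) (I J K : finType) (T : ptensor F I J K).

Section Power.
Variable E : finType.
Implicit Type s : pannot I J K E.

Lemma cardX_tpow u : cardX (tpow T E) u = (\prod_t cardX T (u t))%N.
Proof.
rewrite -card_ffun_forall; apply: eq_card => x; rewrite !inE.
apply/eqP/forallP => [<- t|h]; first by rewrite ffunE.
by apply/ffunP => t; rewrite ffunE; apply/eqP; exact: h.
Qed.

Lemma cardY_tpow u : cardY (tpow T E) u = (\prod_t cardY T (u t))%N.
Proof.
rewrite -card_ffun_forall; apply: eq_card => x; rewrite !inE.
apply/eqP/forallP => [<- t|h]; first by rewrite ffunE.
by apply/ffunP => t; rewrite ffunE; apply/eqP; exact: h.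
Qed.

Lemma cardZ_tpow u : cardZ (tpow T E) u = (\prod_t cardZ T (u t))%N.
Proof.
rewrite -card_ffun_forall; apply: eq_card => x; rewrite !inE.
apply/eqP/forallP => [<- t|h]; first by rewrite ffunE.
by apply/ffunP => t; rewrite ffunE; apply/eqP; exact: h.
Qed.

Lemma monom_tpowP s (x : {ffun E -> varX T}) (y : {ffun E -> varY T})
    (z : {ffun E -> varZ T}) :
  reflect (forall t, (x t, y t, z t) \in monom T (acoord s t))
    (((x, y, z) : varX (tpow T E) * varY (tpow T E) * varZ (tpow T E))
       \in monom (tpow T E) s).
Proof.
case: s => -[u v] w; rewrite inE /annot/=; apply: (iffP andP) => [[/eqP[<- <- <-]]|h].
  by move/prodf_neq0 => h t; rewrite inE /annot /acoord/= !ffunE eqxx h.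
split; last by apply/prodf_neq0 => t _; have := h t; rewrite inE => /andP[].
apply/eqP; congr (_, _, _); apply/ffunP => t; have := h t;
  by rewrite inE /annot /acoord /= ffunE => /andP[/eqP[]].
Qed.

Lemma card_monom_tpow s : #|monom (tpow T E) s| = (\prod_t #|monom T (acoord s t)|)%N.
Proof.
have -> : (\prod_t #|monom T (acoord s t)| =
    \prod_t #|[set q | q \in monom T (acoord s t)]|)%N.
  by apply: eq_bigr => t _; apply: eq_card => q; rewrite inE.
rewrite -card_ffun_forall.
pose h (g : {ffun E -> varX T * varY T * varZ T}) :
    varX (tpow T E) * varY (tpow T E) * varZ (tpow T E) :=
  ([ffun t => (g t).1.1], [ffun t => (g t).1.2], [ffun t => (g t).2]).
have hinj : injective h.
  move=> g g' [/ffunP e1 /ffunP e2 /ffunP e3]; apply/ffunP => t.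
  move: (e1 t) (e2 t) (e3 t); rewrite !ffunE.
  by case: (g t) => -[a b] c; case: (g' t) => -[a' b'] c' /= -> -> ->.
rewrite -(card_imset _ hinj); apply: eq_card => -[[x y] z].
apply/idP/imsetP => [/monom_tpowP hm|[g]].
  exists [ffun t => (x t, y t, z t)].
    by rewrite inE; apply/forallP => t; rewrite ffunE; exact: hm.
  by congr (_, _, _); apply/ffunP => t; rewrite !ffunE.
rewrite inE => /forallP hg [-> -> ->]; apply/monom_tpowP => t.
by rewrite !ffunE; have := hg t; rewrite -!surjective_pairing.
Qed.

End Power.

Lemma supp_tpowP (E : finType) (s : pannot I J K E) :
  reflect (forall t, acoord s t \in supp T) (s \in supp (tpow T E)).
Proof.
rewrite suppE card_monom_tpow; apply: (iffP idP) => [h t|h].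
  rewrite suppE lt0n; apply/eqP => e0; move: h.
  by rewrite (bigD1 t)//= e0 mul0n.
by rewrite prodn_gt0// => t; rewrite -suppE.
Qed.

Section Consistent.
Variables (N : nat) (S : {set pannot I J K 'I_N}) (pi : pattern I J K N).
Hypothesis hS : consistent_for T S pi.
Let E := zeros pi.
Local Notation ar := (arestrict pi).

Lemma consistent_supp0 s (t : E) : s \in S -> acoord (ar s) t \in supp0 T.
Proof.
have [_ hc _] := hS; move=> /hc /(_ (val t)).
by rewrite (eqP (valP t)) /acoord /arestrict /= !ffunE.
Qed.

Lemma acoord_inj (s s' : pannot I J K 'I_N) :
  (forall t, acoord s t = acoord s' t) -> s = s'.
Proof.
case: s s' => -[u v] w [[u' v'] w'] h.
by congr (_, _, _); apply/ffunP => t; have [] := h t.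
Qed.

Lemma acoord_arestrict s (t : E) : acoord (ar s) t = acoord s (val t).
Proof. by rewrite /acoord /= !ffunE. Qed.

Lemma arestrict_inj : {in S &, injective ar}.
Proof.
have [_ hc _] := hS; move=> s s' sS s'S e; apply: acoord_inj => t.
have [pt|pt] := eqVneq (pi t) None.
  have := congr1 (fun r => acoord r (Sub t (introT eqP pt) : E)) e.
  by rewrite !acoord_arestrict.
by move: (hc _ sS t) (hc _ s'S t); case: (pi t) pt => // a _ -> ->.
Qed.

Lemma consistent_mm s : s \in S ->
  (0 < #|monom (tpow T E) (ar s)|)%N /\
  (#|monom (tpow T E) (ar s)| ^ 2)%N =
    (cardX (tpow T E) (ar s).1.1 * cardY (tpow T E) (ar s).1.2 *
     cardZ (tpow T E) (ar s).2)%N.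
Proof.
move=> sS; rewrite card_monom_tpow cardX_tpow cardY_tpow cardZ_tpow -!big_split/=.
have mm t : is_matmul (constituent T (acoord (ar s) t)).
  by have := consistent_supp0 t sS; rewrite inE => /andP[_ /asboolP].
split; first by rewrite prodn_gt0// => t; have [] := Vol_constituent (mm t).
rewrite expnS expn1 -big_split /=; apply: eq_bigr => t _.
by have [_ _ <-] := Vol_constituent (mm t); rewrite expnS expn1.
Qed.

Lemma Vol_sum0 :
  Vol (sum0 T pi S) =
  (\sum_(s in S) \prod_(t < N | pi t == None) #|monom T (acoord s t)|)%N.
Proof.
have [_ _ mm] := hS; rewrite (Vol_constituent_sum mm) (big_imset _ arestrict_inj).
apply: eq_bigr => s sS; rewrite card_monom_tpow.
by rewrite [RHS]prod_sig; apply: eq_bigr => t _; rewrite acoord_arestrict.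
Qed.

Section Projection.
Variables (L : finType) (q : I * J * K -> L) (R : realFieldType).

Definition prj (E' : finType) (s : pannot I J K E') : {ffun E' -> L} :=
  [ffun t => q (acoord s t)].

Lemma prj_arestrict_inj s s' : s \in S -> s' \in S ->
  prj (ar s) = prj (ar s') -> prj s = prj s'.
Proof.
have [_ hc _] := hS; move=> sS s'S e; apply/ffunP => t; rewrite !ffunE.
have [pt|pt] := eqVneq (pi t) None.
  have := congr1 (fun r : {ffun E -> L} => r (Sub t (introT eqP pt))) e.
  by rewrite !ffunE !acoord_arestrict.
by move: (hc _ sS t) (hc _ s'S t); case: (pi t) pt => // a _ -> ->.
Qed.

(** S^(0) lives on the zero coordinates of [pi], whereas the weights are given on all N coordinates.
    The transfer is consistent because annotations of S agree with [pi] on the other coordinates. *)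
Definition push (W : {ffun 'I_N -> L} -> R) (u : {ffun E -> L}) : R :=
  if [pick s in S | prj (ar s) == u] is Some s then W (prj s) else 0.

Lemma push_prj W s : s \in S -> push W (prj (ar s)) = W (prj s).
Proof.
move=> sS; rewrite /push; case: pickP => [s' /andP[s'S /eqP e]|/(_ s)].
  by rewrite (prj_arestrict_inj s'S sS e).
by rewrite sS eqxx.
Qed.

Lemma sum_push W : \sum_(u in [set prj s | s in ar @: S]) push W u =
  \sum_(u in [set prj s | s in S]) W u.
Proof.
pose r (u : {ffun 'I_N -> L}) : {ffun E -> L} := [ffun t => u (val t)].
have rE s : r (prj s) = prj (ar s).
  by apply/ffunP => t; rewrite !ffunE acoord_arestrict.
have -> : [set prj s | s in ar @: S] = r @: [set prj s | s in S].
  by rewrite -!imset_comp; apply: eq_imset => s /=; rewrite rE.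
rewrite big_imset => [|_ _ /imsetP[s sS ->] /imsetP[s' s'S ->]]; last first.
  by rewrite !rE; exact: prj_arestrict_inj.
by apply: eq_bigr => _ /imsetP[s sS ->]; rewrite rE push_prj.
Qed.

End Projection.

Lemma prj_id (E' : finType) (s : pannot I J K E') :
  [/\ prj (fun a => a.1.1) s = s.1.1, prj (fun a => a.1.2) s = s.1.2 &
      prj (fun a => a.2) s = s.2].
Proof. by split; apply/ffunP => t; rewrite ffunE. Qed.

Lemma consistent_loomis_whitney (R : rcfType)
    (WX : {ffun 'I_N -> I} -> R) (WY : {ffun 'I_N -> J} -> R) (WZ : {ffun 'I_N -> K} -> R) :
  (forall u, 0 <= WX u) -> (forall u, 0 <= WY u) -> (forall u, 0 <= WZ u) ->
  (\sum_(s in S) Num.sqrt (WX s.1.1 * WY s.1.2 * WZ s.2)) ^+ 2 <=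
  (\sum_(u in [set s.1.1 | s in S]) WX u) * (\sum_(u in [set s.1.2 | s in S]) WY u) *
  (\sum_(u in [set s.2 | s in S]) WZ u).
Proof.
move=> wX0 wY0 wZ0; have [_ _ mm] := hS.
have push0 (L : finType) (q : I * J * K -> L) (W : {ffun 'I_N -> L} -> R) :
    (forall u, 0 <= W u) -> forall u, 0 <= push q W u.
  by move=> W0 u; rewrite /push; case: pickP.
have := chart_loomis_whitney (push0 _ (fun a => a.1.1) _ wX0)
  (push0 _ (fun a => a.1.2) _ wY0) (push0 _ (fun a => a.2) _ wZ0) mm _.
rewrite (big_imset _ arestrict_inj).
have imE (L : finType) (E' : finType) (q : I * J * K -> L)
   (pr : pannot I J K E' -> {ffun E' -> L}) (A : {set pannot I J K E'}) :
   (forall s, prj q s = pr s) -> [set pr s | s in A] = [set prj q s | s in A].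
  by move=> e; apply: eq_imset => s; rewrite e.
have e1 (E' : finType) (s : pannot I J K E') := let: And3 h _ _ := prj_id s in h.
have e2 (E' : finType) (s : pannot I J K E') := let: And3 _ h _ := prj_id s in h.
have e3 (E' : finType) (s : pannot I J K E') := let: And3 _ _ h := prj_id s in h.
rewrite (imE _ _ _ _ _ (e1 _)) (imE _ _ _ _ _ (e2 _)) (imE _ _ _ _ _ (e3 _)) !sum_push.
rewrite -(imE _ _ _ _ _ (e1 _)) -(imE _ _ _ _ _ (e2 _)) -(imE _ _ _ _ _ (e3 _)).
rewrite (eq_bigr (fun s => Num.sqrt (WX s.1.1 * WY s.1.2 * WZ s.2))).
  by apply=> _ /imsetP[s sS ->]; exact: consistent_mm.
move=> s sS; rewrite -[(ar s).1.1]e1 -[(ar s).1.2]e2 -[(ar s).2]e3 !push_prj//.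
by rewrite e1 e2 e3.
Qed.

End Consistent.
End Powers.

(** * Zero directions at the zero coordinates of a pattern *)

Section Direction.
Variables (F : fieldType) (D : nat) (T : ptensor F 'I_D.+1 'I_D.+1 'I_D.+1).
Local Notation L := 'I_D.+1.
Hypothesis hCW : cw_like T.
Variables (N : nat) (S : {set pannot L L L 'I_N}) (pi : pattern L L L N).
Hypothesis hS : consistent_for T S pi.

(** The variables of a chart of S^(0), read at coordinate t, form a [grid] for the monomials of T,
    so [grid_direction] applies; every annotation of S is met by some monomial of the chart. *)
Lemma consistent_direction t : pi t = None ->
  [\/ forall s, s \in S -> s.1.1 t = ord0, forall s, s \in S -> s.1.2 t = ord0 |
      forall s, s \in S -> s.2 t = ord0].
Proof.
move=> /eqP pt; pose e : zeros pi := Sub t pt.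
have [_ _ [v /mm_chartP[n [m [p [ch [n0 m0 p0 _]]]]]]] := hS.
set S' := [set arestrict pi s | s in S] in ch.
have monoE := @monomials_constituent_sum _ _ _ _ (tpow T (zeros pi)) S'.
pose f i j := chX ch (i, j) e; pose g j k := chY ch (j, k) e; pose h k i := chZ ch (k, i) e.
have inS i j k : exists2 s, s \in S &
   (chX ch (i, j), chY ch (j, k), chZ ch (k, i)) \in monom (tpow T (zeros pi)) (arestrict pi s).
  have := chart_monom ch i j k; rewrite monoE inE => /andP[/imsetP[s sS es] nz].
  by exists s => //; rewrite inE es eqxx.
have at_e i j k s : s \in S ->
    (chX ch (i, j), chY ch (j, k), chZ ch (k, i)) \in monom (tpow T (zeros pi)) (arestrict pi s) ->
    acoord s t = (partX (f i j), partY (g j k), partZ (h k i)) /\ tcoef (f i j) (g j k) (h k i) != 0.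
  by move=> sS /monom_tpowP/(_ e); rewrite inE acoord_arestrict => /andP[/eqP <-].
(* Replacing the variables at e by others of the same parts keeps the annotation, so the new
   monomial still belongs to S^(0) and is named by the chart. *)
have swap i j k x y z : cw_monom (T := T) x y z -> partX x = partX (f i j) ->
    partY y = partY (g j k) -> partZ z = partZ (h k i) ->
    exists i' j' k', [/\ chX ch (i', j') = [ffun t' => if t' == e then x else chX ch (i, j) t'],
      chY ch (j', k') = [ffun t' => if t' == e then y else chY ch (j, k) t'] &
      chZ ch (k', i') = [ffun t' => if t' == e then z else chZ ch (k, i) t']].
  move=> /andP[nz _] px py pz; have [s sS hm] := inS i j k.
  have := @chart_monomP _ _ _ _ _ _ _ _ _ _ _ ch [ffun t' => if t' == e then x else chX ch (i, j) t']
    [ffun t' => if t' == e then y else chY ch (j, k) t']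
    [ffun t' => if t' == e then z else chZ ch (k, i) t'].
  rewrite monoE => /(_ _)[|i' [j' [k' [-> -> ->]]]]; last by exists i', j', k'.
  have {}nm : ([ffun t' => if t' == e then x else chX ch (i, j) t'],
    [ffun t' => if t' == e then y else chY ch (j, k) t'],
    [ffun t' => if t' == e then z else chZ ch (k, i) t'])
       \in monom (tpow T (zeros pi)) (arestrict pi s).
    apply/monom_tpowP => t'; rewrite !ffunE; case: eqP => [->|_].
      have [ae _] := at_e _ _ _ _ sS hm.
      by rewrite inE nz acoord_arestrict ae /annot/= px py pz eqxx.
    exact: (elimT (monom_tpowP _ _ _ _) hm).
  move: nm; rewrite inE => /andP[/eqP es nz']; rewrite inE es nz' andbT.
  exact: imset_f.
have eqf (V : Type) (c : {ffun zeros pi -> V}) : [ffun t' => if t' == e then c e else c t'] = c.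
  by apply/ffunP => t'; rewrite ffunE; case: eqP => [->|].
have hG : grid (cw_monom (T := T)) (@partX _ _ _ _ T) (@partY _ _ _ _ T) (@partZ _ _ _ _ T) f g h.
  split.
    move=> i j k; have [s sS hm] := inS i j k; have [ae nz] := at_e _ _ _ _ sS hm.
    rewrite /cw_monom nz -ae; have := consistent_supp0 hS e sS.
    by rewrite acoord_arestrict.
  split.
  - move=> i j k x y Mxyz px py.
    have [i' [j' [k' [ex ey ez]]]] := swap i j k x y _ Mxyz px py erefl.
    (* The z-variable has not changed, so injectivity of the chart fixes k and i, and only j
       moves. *)
    move: ez; rewrite eqf => /(@chZ_inj _ _ _ _ _ _ _ _ _ _ _ ch)[ek ei].
    by exists j'; rewrite /f /g -ei -ek ex ey !ffunE eqxx.
  - move=> j k i y z Mxyz py pz.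
    have [i' [j' [k' [ex ey ez]]]] := swap i j k _ y z Mxyz erefl py pz.
    move: ex; rewrite eqf => /(@chX_inj _ _ _ _ _ _ _ _ _ _ _ ch)[ei ej].
    by exists k'; rewrite /g /h -ei -ej ez ey !ffunE eqxx.
  - move=> k i j z x Mxyz pz px.
    have [i' [j' [k' [ex ey ez]]]] := swap i j k x _ z Mxyz px erefl pz.
    move: ey; rewrite eqf => /(@chY_inj _ _ _ _ _ _ _ _ _ _ _ ch)[ej ek].
    by exists i'; rewrite /f /h -ek -ej ez ex !ffunE eqxx.
have inCh s : s \in S -> exists i j k,
    acoord s t = (partX (f i j), partY (g j k), partZ (h k i)).
  move=> sS; have [/card_gt0P[[[x y] z] hm] _] := consistent_mm hS sS.
  have := @chart_monomP _ _ _ _ _ _ _ _ _ _ _ ch x y z; rewrite monoE.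
  have hm' : (x, y, z) \in monom_sum (tpow T (zeros pi)) S'.
    by move: hm; rewrite inE => /andP[/eqP es nz]; rewrite inE es nz imset_f.
  move=> /(_ hm')[i [j [k [ex ey ez]]]]; exists i, j, k.
  by rewrite ex ey ez in hm; have [] := at_e _ _ _ _ sS hm.
have [hf|hg|hh] := grid_direction (Ordinal n0) (Ordinal m0) (Ordinal p0) (cw_like_rel hCW) hG.
- by apply: Or31 => s /inCh[i [j [k [-> _ _]]]].
- by apply: Or32 => s /inCh[i [j [k [_ -> _]]]].
- by apply: Or33 => s /inCh[i [j [k [_ _ ->]]]].
Qed.

End Direction.

(** * Types and their symmetrized distributions *)

Section Types.
Variables (I : finType).
Local Notation I3 := (I * I * I)%type.

Definition rot3 (a : I3) : I3 := (a.1.2, a.2, a.1.1).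

Lemma rot3K a : rot3 (rot3 (rot3 a)) = a.
Proof. by case: a => -[]. Qed.

Definition occ (a : I3) (i : I) : nat := (a.1.1 == i) + (a.1.2 == i) + (a.2 == i).

(** A count is at most N, so [inord] loses nothing; values in 'I_N.+1 bound the number of types by a
    power of N + 1. *)
Definition atype (N : nat) (s : pannot I I I 'I_N) : {ffun I3 -> 'I_N.+1} :=
  [ffun a => inord #|[set t | acoord s t == a]|].

Lemma atypeE N (s : pannot I I I 'I_N) a :
  atype s a = #|[set t | acoord s t == a]| :> nat.
Proof. by rewrite ffunE inordK// ltnS -[leqRHS]card_ord max_card. Qed.

Lemma prod_atype (R : comNzSemiRingType) N (s : pannot I I I 'I_N) (q : I3 -> R) :
  \prod_t q (acoord s t) = \prod_a q a ^+ atype s a.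
Proof.
rewrite (partition_big (acoord s) xpredT)//=; apply: eq_bigr => a _.
rewrite (eq_bigr (fun=> q a)) => [|t /eqP ->//]; rewrite prodr_const atypeE.
by congr (_ ^+ _); apply: eq_card => t; rewrite inE.
Qed.

Lemma sum_atype N (s : pannot I I I 'I_N) : (\sum_a atype s a)%N = N.
Proof.
rewrite -[RHS](card_ord N) -sum1_card (partition_big (acoord s) xpredT)//=.
by apply: eq_bigr => a _; rewrite sum1_card atypeE; apply: eq_card => t; rewrite inE.
Qed.

Lemma atype_gt0 N (s : pannot I I I 'I_N) t : (0 < atype s (acoord s t))%N.
Proof. by rewrite atypeE; apply/card_gt0P; exists t; rewrite inE. Qed.

Lemma atype_eq0 N (s : pannot I I I 'I_N) a :
  (forall t, acoord s t != a) -> atype s a = 0%N :> nat.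
Proof.
move=> h; rewrite atypeE; apply: eq_card0 => t; rewrite inE; exact/negbTE/h.
Qed.

Lemma prod_exp_eq (R : comNzSemiRingType) (p : I -> R) a :
  \prod_i p i ^+ (a == i) = p a.
Proof.
rewrite (bigD1 a)//= eqxx expr1 big1 ?mulr1// => i /negbTE ia.
by rewrite eq_sym ia expr0.
Qed.

Lemma prod_exp_occ (R : comNzSemiRingType) (p : I -> R) a :
  \prod_i p i ^+ occ a i = p a.1.1 * p a.1.2 * p a.2.
Proof.
by under eq_bigr => i _ do rewrite !exprD; rewrite !big_split/= !prod_exp_eq.
Qed.

Lemma prod_atype_exp (R : comNzSemiRingType) N (s : pannot I I I 'I_N) (p : I -> R)
    (c : I3 -> I -> nat) :
  \prod_t \prod_i p i ^+ c (acoord s t) i =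
  \prod_i p i ^+ (\sum_a c a i * atype s a).
Proof.
rewrite (prod_atype s (fun a => \prod_i p i ^+ c a i)).
under eq_bigr => a _ do rewrite -prodrXl.
rewrite exchange_big/=; apply: eq_bigr => i _.
by rewrite -prodrXr; apply: eq_bigr => a _; rewrite exprM.
Qed.

End Types.

Section Symmetrization.
Variables (R : realType) (I : finType) (N : nat).
Local Notation I3 := (I * I * I)%type.
Variable tau : {ffun I3 -> 'I_N.+1}.
Hypothesis N_gt0 : (0 < N)%N.

(** Averages of rotation-invariant functions are the same under this distribution as under the type
    itself, and only such averages enter the bounds. *)
Definition symmetrize : {ffun I3 -> R} :=
  [ffun a => (tau a + tau (rot3 a) + tau (rot3 (rot3 a)))%N%:R / (3 * N%:R)].

Lemma symmetrize_ge0 a : 0 <= symmetrize a.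
Proof. by rewrite ffunE divr_ge0. Qed.

Lemma sum_symmetrize (phi : I3 -> R) :
  3 * N%:R * \sum_a symmetrize a * phi a =
  \sum_a (tau a)%:R * (phi a + phi (rot3 a) + phi (rot3 (rot3 a))).
Proof.
pose r (a : I3) := rot3 a; pose r2 (a : I3) := rot3 (rot3 a).
have rK : cancel r r2 by exact: rot3K.
have r2K : cancel r2 r by exact: rot3K.
have bij1 : bijective r by exists r2.
have bij2 : bijective r2 by exists r.
have eB : \sum_a (tau (rot3 a))%:R * phi a = \sum_a (tau a)%:R * phi (rot3 (rot3 a)).
  rewrite (reindex r2) /=; last exact: onW_bij.
  by apply: eq_bigr => a _; rewrite /r2 rot3K.
have eC : \sum_a (tau (rot3 (rot3 a)))%:R * phi a = \sum_a (tau a)%:R * phi (rot3 a).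
  rewrite (reindex r) /=; last exact: onW_bij.
  by apply: eq_bigr => a _; rewrite /r rot3K.
under [RHS]eq_bigr => a _ do rewrite !mulrDr.
rewrite !big_split/= -eB -eC -!big_split mulr_sumr; apply: eq_bigr => a _ /=.
have Nr : N%:R != 0 :> R by rewrite pnatr_eq0 -lt0n.
by rewrite ffunE !natrD; field.
Qed.

Lemma sum_symmetrize_inv (phi : I3 -> R) : (forall a, phi (rot3 a) = phi a) ->
  N%:R * \sum_a symmetrize a * phi a = \sum_a (tau a)%:R * phi a.
Proof.
move=> inv; apply: (@mulfI R 3); first by rewrite pnatr_eq0.
rewrite mulrA sum_symmetrize mulr_sumr; apply: eq_bigr => a _.
by rewrite !inv; ring.
Qed.

Lemma symmetrize_rot a : symmetrize (rot3 a) = symmetrize a.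
Proof. by rewrite !ffunE rot3K; congr (_%:R / _); rewrite addnC addnA. Qed.

End Symmetrization.

(** * Marginals and Ptilde as counts of occurrences *)

Section Marginals.
Variables (R : realType) (F : fieldType) (D : nat).
Variable T : ptensor F 'I_D.+1 'I_D.+1 'I_D.+1.
Local Notation L := 'I_D.+1.
Local Notation L3 := (L * L * L)%type.
Hypotheses (hCW : cw_like T) (hsym : symmetric_ptensor T).

Lemma rot3_supp a : (rot3 a \in supp T) = (a \in supp T).
Proof.
have h b : b \in supp T -> rot3 b \in supp T by case: b => -[i j] k /(supp_rot hsym).
by apply/idP/idP => [/h/h|/h//]; rewrite rot3K.
Qed.

Lemma rot3_supp0 a : (rot3 a \in supp0 T) = (a \in supp0 T).
Proof.
case: a => -[i j] k; rewrite /rot3 /= !(supp0_zero hCW).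
rewrite -[(j, k, i)]/(rot3 (i, j, k)) rot3_supp; congr (_ && _).
by rewrite [RHS]orbC orbA.
Qed.

(* Occurrences of i in a after removing one zero entry; the truncated
   subtraction is exact on supp0 T. *)
Definition occ0 (a : L3) (i : L) : nat := occ a i - (i == ord0).

Lemma occ0K a i : a \in supp0 T -> (occ0 a i + (i == ord0))%N = occ a i.
Proof.
move=> a0; rewrite subnK//; case: eqP => // ->.
case: a a0 => -[x y] z; rewrite (supp0_zero hCW) /occ /= => /andP[_].
by case: (x == _); case: (y == _); case: (z == _).
Qed.

Lemma occ_rot a (i : L) : occ (rot3 a) i = occ a i.
Proof. by rewrite /occ addnC addnA. Qed.

Lemma sum_eq_ord (x : L) : (\sum_i (x == i) = 1)%N.
Proof.
by rewrite (bigD1 x)//= eqxx big1// => i; rewrite eq_sym => /negbTE ->.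
Qed.

Lemma sum_occ0 a : a \in supp0 T -> (\sum_i occ0 a i = 2)%N.
Proof.
move=> a0; apply: (@addIn 1); rewrite -[X in (_ + X)%N](sum_eq_ord ord0) -big_split /=.
under eq_bigr => i _ do rewrite [ord0 == i]eq_sym occ0K//.
by rewrite /occ !big_split /= !sum_eq_ord.
Qed.

Section Sdist.
Variable P : {ffun L3 -> R}.
Hypothesis hP : sdist T P.

Lemma sdist_ge0 a : 0 <= P a. Proof. by case: hP. Qed.

Lemma sdist_supp a : a \notin supp T -> P a = 0. Proof. by case: hP => _ h _ _; exact: h. Qed.

Lemma sum_sdist_rot (phi : L3 -> R) : \sum_a P a * phi (rot3 a) = \sum_a P a * phi a.
Proof.
have rotP a : P (rot3 a) = P a by case: hP => _ _ _ h; case: a => -[i j] k; exact/esym/h.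
rewrite [RHS](reindex (@rot3 _)) /=; last first.
  by apply: onW_bij; exists (fun a => rot3 (rot3 a)); exact: rot3K.
by apply: eq_bigr => a _; rewrite rotP.
Qed.

(** Since P is rotation invariant, occurrences of i in the first position weigh as much as those in
    the second or third. *)
Lemma sum_sdist_occ (w : L3 -> R) i : (forall a, w (rot3 a) = w a) ->
  3 * (\sum_a P a * (w a * (a.1.1 == i)%:R)) = \sum_a P a * (w a * (occ a i)%:R).
Proof.
move=> inv; pose phi a := w a * (a.1.1 == i)%:R.
have -> : 3 * \sum_a P a * phi a = \sum_a P a * phi a + \sum_a P a * phi (rot3 a) +
    \sum_a P a * phi (rot3 (rot3 a)).
  by rewrite (sum_sdist_rot (fun a => phi (rot3 a))) sum_sdist_rot; ring.
rewrite -!big_split /=; apply: eq_bigr => a _.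
by rewrite /phi !inv /occ !natrD /=; ring.
Qed.

Lemma marginalE i : marginal T P i = \sum_a P a * (a.1.1 == i)%:R.
Proof.
rewrite /marginal big_mkcond; apply: eq_bigr => a _.
case: (boolP (a \in supp T)) => [aT|/sdist_supp ->]; last by rewrite mul0r.
by case: eqP => _; rewrite ?mulr1 ?mulr0.
Qed.

Lemma marginal_occ i : 3 * marginal T P i = \sum_a P a * (occ a i)%:R.
Proof.
transitivity (\sum_a P a * (1 * (occ a i)%:R)); last first.
  by apply: eq_bigr => a _; rewrite mul1r.
rewrite -(@sum_sdist_occ (fun=> 1))// marginalE; congr (_ * _).
by apply: eq_bigr => a _; rewrite mul1r.
Qed.

Lemma marginal_ge0 i : 0 <= marginal T P i.
Proof. by apply: sumr_ge0 => a _; exact: sdist_ge0. Qed.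

Lemma sum_marginal : \sum_i marginal T P i = 1.
Proof.
have [_ Psupp <- _] := hP.
rewrite (bigID (mem (supp T))) /= [X in _ = _ + X]big1 ?addr0//.
by rewrite /marginal -(partition_big (fun s : L3 => s.1.1) xpredT).
Qed.

Lemma P0_ge0 : 0 <= P0 T P.
Proof. by apply: sumr_ge0 => a _; exact: sdist_ge0. Qed.

(** This is 2 P_0 Ptilde(i) written without division by P_0. *)
Definition unzero (i : L) : R := \sum_(a in supp0 T) P a * (occ0 a i)%:R.

Lemma unzero_ge0 i : 0 <= unzero i.
Proof. by apply: sumr_ge0 => a _; rewrite mulr_ge0// sdist_ge0. Qed.

Lemma sum_unzero : \sum_i unzero i = 2 * P0 T P.
Proof.
rewrite /unzero exchange_big /= /P0 mulr_sumr; apply: eq_bigr => a a0.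
by rewrite -mulr_sumr -natr_sum sum_occ0// mulrC.
Qed.

(** By symmetry, three times the marginal of P on supp_0(T) counts all occurrences of i, and
    removing one zero from each annotation subtracts P_0 at i = 0. If P_0 = 0, all values of
    [unzero] are nonnegative with sum 0. *)
Lemma Ptilde_unzero i : 2 * P0 T P * Ptilde T P i = unzero i.
Proof.
have [P00|P0n] := eqVneq (P0 T P) 0.
  rewrite P00 mulr0 mul0r; apply/esym/eqP; rewrite eq_le unzero_ge0 andbT.
  have <- : \sum_i unzero i = 0 by rewrite sum_unzero P00 mulr0.
  by rewrite (bigD1 i)//= lerDl sumr_ge0// => j _; exact: unzero_ge0.
pose w a : R := (a \in supp0 T)%:R.
pose Y := \sum_a P a * (w a * (a.1.1 == i)%:R).
have Y3 : 3 * Y = unzero i + (i == ord0)%:R * P0 T P.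
  rewrite /Y sum_sdist_occ => [|a]; last by rewrite /w rot3_supp0.
  rewrite /unzero /P0 mulr_sumr -big_split [RHS]big_mkcond /=; apply: eq_bigr => a _.
  rewrite /w; case: ifP => [a0|_]; last by rewrite mul0r mulr0.
  by rewrite mul1r -(occ0K i a0) natrD; ring.
have XY : (if i == ord0 then marginal T P ord0 - P0 T P / 3
    else marginal T P i - marginal T (Pstar T P) i) = Y - (i == ord0)%:R * P0 T P / 3.
  (* At i = 0 nothing of P* has to be subtracted: an annotation with a zero entry lies in
     supp_0(T). *)
  have [i0|i0] := eqVneq i ord0.
    rewrite mul1r /Y i0; congr (_ - _); rewrite marginalE; apply: eq_bigr => -[[x y] z] _ /=.
    rewrite /w (supp0_zero hCW); case: (boolP (_ \in supp T)) => [_|/sdist_supp ->] /=.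
      by case: (x == ord0); rewrite ?mul1r ?mulr0.
    by rewrite !mul0r.
  rewrite mul0r mul0r subr0 marginalE.
  have -> : marginal T (Pstar T P) i = \sum_a P a * ((a \in suppstar T) && (a.1.1 == i))%:R.
    rewrite /marginal big_mkcond; apply: eq_bigr => a _; rewrite ffunE.
    rewrite /suppstar finset.in_setD; case: (a \in supp T) => /=; last by rewrite andbF mulr0.
    by case: (a \in supp0 T); case: eqP => _ /=; rewrite ?mulr1 ?mulr0.
  rewrite -sumrB; apply: eq_bigr => a _; rewrite -mulrBr /suppstar finset.in_setD /w.
  case: (boolP (a \in supp T)) => [aT|aT]; last by rewrite sdist_supp// !mul0r.
  by case: (a \in supp0 T); case: eqP => _ /=; congr (_ * _);
    rewrite ?mul1r ?mul0r ?subr0 ?subrr.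
rewrite /Ptilde XY.
have -> : 2 * P0 T P * (3 / (2 * P0 T P) * (Y - (i == ord0)%:R * P0 T P / 3)) =
    3 * Y - (i == ord0)%:R * P0 T P by field.
by rewrite Y3 addrK.
Qed.

Lemma Ptilde_ge0 i : 0 <= Ptilde T P i.
Proof.
have [P00|P0n] := eqVneq (P0 T P) 0.
  by rewrite /Ptilde P00 mulr0 invr0 mulr0 mul0r.
have c0 : 0 < 2 * P0 T P by rewrite mulr_gt0// lt_neqAle eq_sym P0n P0_ge0.
by rewrite -(pmulr_rge0 _ c0) Ptilde_unzero unzero_ge0.
Qed.

Lemma sum_Ptilde : P0 T P != 0 -> \sum_i Ptilde T P i = 1.
Proof.
move=> P0n; have c0 : 2 * P0 T P != 0 by rewrite mulf_neq0// pnatr_eq0.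
apply: (mulfI c0); rewrite mulr1 mulr_sumr -[RHS]sum_unzero.
by apply: eq_bigr => i _; rewrite Ptilde_unzero.
Qed.

End Sdist.

Section Profile.
Variable N : nat.
Hypothesis N_gt0 : (0 < N)%N.
Variable s0 : pannot L L L 'I_N.
Hypothesis s0_supp : forall t, acoord s0 t \in supp T.
Local Notation tau := (atype s0).
Local Notation P := (symmetrize R tau).

Lemma atype_nsupp a : a \notin supp T -> tau a = 0%N :> nat.
Proof.
by move=> aT; apply: atype_eq0 => t; apply: contraNneq aT => <-.
Qed.

Lemma sdist_symmetrize : sdist T P.
Proof.
split.
- by move=> a; exact: symmetrize_ge0.
- by move=> a aT; rewrite ffunE !atype_nsupp ?rot3_supp// mul0r.
- have := @sum_symmetrize_inv R _ _ tau N_gt0 (fun=> 1) (fun=> erefl).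
  under eq_bigr => a _ do rewrite mulr1.
  under [X in _ = X]eq_bigr => a _ do rewrite mulr1.
  rewrite -natr_sum sum_atype => e; have Nn : N%:R != 0 :> R by rewrite pnatr_eq0 -lt0n.
  by apply: (mulfI Nn); rewrite mulr1.
- by move=> i j k; rewrite -[(j, k, i)]/(rot3 (i, j, k)) symmetrize_rot.
Qed.

Lemma P0_symmetrize : N%:R * P0 T P = (\sum_(a in supp0 T) tau a)%:R.
Proof.
have := @sum_symmetrize_inv R _ _ tau N_gt0 (fun a => (a \in supp0 T)%:R).
have -> : \sum_a P a * (a \in supp0 T)%:R = P0 T P.
  rewrite /P0 [RHS]big_mkcond; apply: eq_bigr => a _.
  by case: (a \in _); rewrite ?mulr1 ?mulr0.
move=> -> => [|a]; last by rewrite rot3_supp0.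
rewrite natr_sum [RHS]big_mkcond; apply: eq_bigr => a _.
by case: (a \in _); rewrite ?mulr1 ?mulr0.
Qed.

(** Altogether the index i occurs 3 N P_m(i) times in the three components of [s0]. *)
Lemma prod_marginal :
  \prod_t (marginal T P (s0.1.1 t) * marginal T P (s0.1.2 t) * marginal T P (s0.2 t)) =
  expR (- (3 * N%:R * ln 2 * entropy (marginal T P))).
Proof.
rewrite -(prod_exp_entropy (marginal_ge0 sdist_symmetrize)
  (e := fun i => \sum_a occ a i * tau a)%N).
  rewrite -(prod_atype_exp s0 _ (@occ _)); apply: eq_bigr => t _.
  by rewrite prod_exp_occ.
move=> i; rewrite mulrAC (marginal_occ sdist_symmetrize) mulrC.
rewrite (@sum_symmetrize_inv R _ _ tau N_gt0 (fun a => (occ a i)%:R)) => [|a].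
  by rewrite natr_sum; apply: eq_bigr => a _; rewrite natrM mulrC.
by rewrite occ_rot.
Qed.

(** After one zero is removed at each coordinate in supp_0(T), the index i occurs 2 N P_0 Ptilde(i)
    times. *)
Lemma prod_Ptilde :
  \prod_t (if acoord s0 t \in supp0 T then
             \prod_i Ptilde T P i ^+ occ0 (acoord s0 t) i else 1) =
  expR (- (2 * N%:R * P0 T P * ln 2 * entropy (Ptilde T P))).
Proof.
pose c a i := ((a \in supp0 T) * occ0 a i)%N.
rewrite -(prod_exp_entropy (Ptilde_ge0 sdist_symmetrize)
  (e := fun i => \sum_a c a i * tau a)%N) => [|i]; last first.
  have -> : 2 * N%:R * P0 T P * Ptilde T P i = N%:R * (2 * P0 T P * Ptilde T P i) by ring.
  rewrite (Ptilde_unzero sdist_symmetrize) /unzero.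
  have e := @sum_symmetrize_inv R _ _ tau N_gt0 (fun a => (c a i)%:R).
  rewrite natr_sum; transitivity (\sum_a (tau a)%:R * (c a i)%:R : R).
    by apply: eq_bigr => a _; rewrite natrM mulrC.
  rewrite -e => [|a]; last by rewrite /c rot3_supp0 /occ0 occ_rot.
  congr (_ * _); rewrite [RHS]big_mkcond; apply: eq_bigr => a _; rewrite /c.
  by case: (a \in _); rewrite ?mul1n// mul0n mulr0.
rewrite -(prod_atype_exp s0 _ c); apply: eq_bigr => t _; rewrite /c.
case: (_ \in _); first by apply: eq_bigr => i _; rewrite mul1n.
by rewrite big1// => i _; rewrite mul0n expr0.
Qed.

End Profile.
End Marginals.

Lemma sum_prod_le (R : numDomainType) (E V : finType) (c : E -> V -> R)
    (A : {set {ffun E -> V}}) : (forall t v, 0 <= c t v) ->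
  \sum_(u in A) \prod_t c t (u t) <= \prod_t \sum_v c t v.
Proof.
move=> c0; rewrite bigA_distr_bigA big_mkcond /=; apply: ler_sum => u _.
by case: ifP => // _; apply: prodr_ge0.
Qed.

(** * Annotations of one type in a consistent sum *)

Section ClassBound.
Variables (R : realType) (F : fieldType) (D : nat).
Variable T : ptensor F 'I_D.+1 'I_D.+1 'I_D.+1.
Local Notation L := 'I_D.+1.
Local Notation L3 := (L * L * L)%type.
Hypotheses (hCW : cw_like T) (hsym : symmetric_ptensor T).
Variable N : nat.
Hypothesis N_gt0 : (0 < N)%N.
Variables (S : {set pannot L L L 'I_N}) (pi : pattern L L L N).
Hypothesis hS : consistent_for T S pi.
Variable tau : {ffun L3 -> 'I_N.+1}.
Local Notation P := (symmetrize R tau).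

Definition type_class : {set pannot L L L 'I_N} := [set s in S | atype s == tau].

Lemma consistent_supp s t : s \in S -> acoord s t \in supp T.
Proof.
have [hp hc _] := hS; move=> /hc/(_ t); case e: (pi t) => [a|].
  by move=> ->; have := hp _ _ e; rewrite finset.in_setD => /andP[].
by rewrite inE => /andP[].
Qed.

(** If the product of the three weights is a constant k on the type class, the terms of this class
    alone contribute its size times sqrt k to the Loomis-Whitney sum. *)
Lemma type_class_weights (WX WY WZ : {ffun 'I_N -> L} -> R) (k : R) :
  (forall u, 0 <= WX u) -> (forall u, 0 <= WY u) -> (forall u, 0 <= WZ u) ->
  0 <= k -> (forall s, s \in type_class -> WX s.1.1 * WY s.1.2 * WZ s.2 = k) ->
  #|type_class|%:R ^+ 2 * k <=
  (\sum_(u in [set s.1.1 | s in S]) WX u) * (\sum_(u in [set s.1.2 | s in S]) WY u) *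
  (\sum_(u in [set s.2 | s in S]) WZ u).
Proof.
move=> X0 Y0 Z0 k0 hk; apply: le_trans (consistent_loomis_whitney hS X0 Y0 Z0).
rewrite -[k in leLHS]sqr_sqrtr// -exprMn; apply: lerXn2r.
- by rewrite nnegrE mulr_ge0// sqrtr_ge0.
- by rewrite nnegrE sumr_ge0// => s _; exact: sqrtr_ge0.
rewrite mulr_natl -sumr_const [leRHS](big_setID type_class)/=.
have /finset.setIidPr -> : type_class \subset S by apply/fintype.subsetP => s; rewrite inE => /andP[].
rewrite (eq_bigr (fun s => Num.sqrt (WX s.1.1 * WY s.1.2 * WZ s.2))) => [|s /hk -> //].
by rewrite lerDl sumr_ge0// => s _; exact: sqrtr_ge0.
Qed.

Lemma type_class_marginal :
  #|type_class|%:R ^+ 2 <= expR (3 * N%:R * ln 2 * entropy (marginal T P)) *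
  ((\sum_(u in [set s.1.1 | s in S]) \prod_t marginal T P (u t)) *
   (\sum_(u in [set s.1.2 | s in S]) \prod_t marginal T P (u t)) *
   (\sum_(u in [set s.2 | s in S]) \prod_t marginal T P (u t))).
Proof.
have W0 (u : {ffun 'I_N -> L}) : 0 <= \prod_t marginal T P (u t).
  by apply: prodr_ge0 => t _; apply: sumr_ge0 => a _; exact: symmetrize_ge0.
set e := 3 * N%:R * ln 2 * _.
rewrite mulrC -ler_pdivrMr ?expR_gt0// -expRN.
apply: type_class_weights => //.
move=> s; rewrite inE => /andP[sS /eqP st]; rewrite -!big_split /= /e -st.
by rewrite prod_marginal// => t; exact: consistent_supp.
Qed.

Lemma type_class_Ptilde :
  #|type_class|%:R <= expR (N%:R * P0 T P * ln 2 * entropy (Ptilde T P)).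
Proof.
have [c0|[s1 s1C]] := set_0Vmem type_class; first by rewrite c0 cards0 expR_ge0.
have [s1S st1] : s1 \in S /\ atype s1 = tau.
  by move: s1C; rewrite inE => /andP[? /eqP].
have supp1 := fun t => consistent_supp t s1S.
set e := N%:R * _ * _ * _.
suff : #|type_class|%:R ^+ 2 * expR (- (2 * e)) <= 1.
  rewrite expRN ler_pdivrMr ?expR_gt0// mul1r expRM_natl.
  by rewrite ler_pXn2r// nnegrE ?expR_ge0.
pose p := Ptilde T P.
have p0 i : 0 <= p i.
  by rewrite /p -st1; apply: Ptilde_ge0 => //; exact: sdist_symmetrize.
have [hpat hconf _] := hS.
(* Every zero coordinate is assigned one direction in which all annotations of S have index 0; x
   comes before y, and y before z. *)
pose dX t := [forall s in S, s.1.1 t == ord0].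
pose dY t := ~~ dX t && [forall s in S, s.1.2 t == ord0].
pose dZ t := ~~ dX t && ~~ dY t.
(* Factors of the weights: a point mass at the index prescribed by [pi], a point mass at 0 in the
   assigned direction, and Ptilde in the two other directions. Each has total mass 1, so the three
   index sums are at most 1. *)
pose c (q : L3 -> L) (d : 'I_N -> bool) t i : R :=
  if pi t is Some a then (i == q a)%:R else if d t then (i == ord0)%:R else p i.
have c_ge0 q d t i : 0 <= c q d t i by rewrite /c; case: (pi t) => [a|]//; case: ifP.
have sum1 (x : L) : \sum_i (i == x)%:R = 1 :> R.
  by rewrite (bigD1 x)//= eqxx big1 ?addr0// => i /negbTE ->.
have sum_c q d t : \sum_i c q d t i = 1.
  rewrite /c; case e1: (pi t) => [a|]; first exact: sum1.
  case: (d t); first exact: sum1.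
  (* The type has an annotation in supp_0(T), so P_0 is nonzero and Ptilde is a probability
     distribution. *)
  have a0 : acoord s1 t \in supp0 T by move: (hconf _ s1S t); rewrite e1.
  have s1d : sdist T P by rewrite -st1; apply: sdist_symmetrize.
  apply: (sum_Ptilde hCW hsym s1d); rewrite -st1; apply/eqP => P00.
  have /eqP := P0_symmetrize R hCW hsym N_gt0 s1.
  rewrite P00 mulr0 eq_sym pnatr_eq0 sum_nat_eq0 => /forall_inP/(_ _ a0).
  by rewrite eqn0Ngt atype_gt0.
have sum_W q d (A : {set {ffun 'I_N -> L}}) : \sum_(u in A) \prod_t c q d t (u t) <= 1.
  by apply: le_trans (sum_prod_le _ (c_ge0 q d)) _; rewrite big1.
have W_ge0 q d (u : {ffun 'I_N -> L}) : 0 <= \prod_t c q d t (u t) by apply: prodr_ge0.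
have hk s : s \in type_class ->
    (\prod_t c (fun a => a.1.1) dX t (s.1.1 t)) * (\prod_t c (fun a => a.1.2) dY t (s.1.2 t)) *
    (\prod_t c (fun a => a.2) dZ t (s.2 t)) = expR (- (2 * e)).
  rewrite inE => /andP[sS /eqP st].
  have suppS := fun t => consistent_supp t sS.
  have -> : 2 * e = 2 * N%:R * P0 T P * ln 2 * entropy (Ptilde T P) by rewrite /e; ring.
  rewrite -{1 2}st -(prod_Ptilde R hCW hsym N_gt0 suppS) -!big_split /=.
  apply: eq_bigr => t _; rewrite /c; have := hconf _ sS t.
  case e1: (pi t) => [a|] at_.
    rewrite at_; have := hpat _ _ e1; rewrite finset.in_setD => /andP[/negbTE -> _].
    by rewrite -at_ /= !eqxx !mulr1.
  rewrite at_ st; have zX : dX t -> s.1.1 t = ord0 by move=> /forall_inP/(_ _ sS)/eqP.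
  have zY : dY t -> s.1.2 t = ord0 by case/andP => _ /forall_inP/(_ _ sS)/eqP.
  (* When x and y are ruled out, [consistent_direction] leaves z. *)
  have zZ : dZ t -> s.2 t = ord0.
    rewrite /dZ /dY; case: (boolP (dX t)) => //= nX nY.
    have [h|h|h] := consistent_direction hCW hS e1; last exact: h.
      by case/negP: nX; apply/forall_inP => s' /h ->.
    by case/negP: nY; apply/forall_inP => s' /h ->.
  (* Deleting the zero of the assigned direction leaves the two entries x and y that carry the
     factor Ptilde. *)
  have two (x y : L) (b : L3) : (forall i, occ b i = (x == i) + (y == i) + (ord0 == i))%N ->
      \prod_i p i ^+ occ0 b i = p x * p y.
    move=> hb; rewrite -(prod_exp_eq p x) -(prod_exp_eq p y) -big_split /=.
    by apply: eq_bigr => i _; rewrite /occ0 hb [ord0 == i]eq_sym addnK exprD.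
  rewrite /dZ; case: (boolP (dX t)) => hX /=.
    rewrite (zX hX) eqxx /dY hX /= mul1r; apply/esym/two => i.
    by rewrite /occ /acoord /= (zX hX) addnC addnA addnAC addnC addnA; ring.
  case: (boolP (dY t)) => hY /=.
    rewrite (zY hY) eqxx mulr1; apply/esym/two => i.
    by rewrite /occ /acoord /= (zY hY); ring.
  have hZ : dZ t by rewrite /dZ hX hY.
  by rewrite (zZ hZ) eqxx mulr1; apply/esym/two => i; rewrite /occ /acoord /= (zZ hZ).
apply: le_trans (type_class_weights (W_ge0 _ _) (W_ge0 _ _) (W_ge0 _ _) (expR_ge0 _) hk) _.
have S0 q d (A : {set {ffun 'I_N -> L}}) : 0 <= \sum_(u in A) \prod_t c q d t (u t).
  by apply: sumr_ge0.
by apply: mulr_ile1; rewrite ?mulr_ge0//; apply: mulr_ile1.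
Qed.

Lemma type_class_power (rho : R) : 2 <= rho <= 3 ->
  #|type_class|%:R `^ (rho / 3) <=
  expR (N%:R * ln 2 * (entropy (marginal T P) + (rho - 2) / 3 * (P0 T P * entropy (Ptilde T P)))) *
  ((\sum_(u in [set s.1.1 | s in S]) \prod_t marginal T P (u t) +
    \sum_(u in [set s.1.2 | s in S]) \prod_t marginal T P (u t) +
    \sum_(u in [set s.2 | s in S]) \prod_t marginal T P (u t)) / 3).
Proof.
move=> /andP[r2 r3]; set n := #|type_class|.
set A := \sum_(u in [set s.1.1 | s in S]) _.
set B := \sum_(u in [set s.1.2 | s in S]) _; set C := \sum_(u in [set s.2 | s in S]) _.
have W0 (u : {ffun 'I_N -> L}) : 0 <= \prod_t marginal T P (u t).
  by apply: prodr_ge0 => t _; apply: sumr_ge0 => a _; exact: symmetrize_ge0.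
have A0 : 0 <= A by apply: sumr_ge0.
have B0 : 0 <= B by apply: sumr_ge0.
have C0 : 0 <= C by apply: sumr_ge0.
have nn : 0 <= n%:R :> R by [].
(* The first factor is bounded by [type_class_marginal], the second by [type_class_Ptilde]. *)
have -> : n%:R `^ (rho / 3) = (n%:R ^+ 2) `^ 3^-1 * n%:R `^ ((rho - 2) / 3) :> R.
  rewrite -powR_mulrn// -powRrM -powRD; first by congr (_ `^ _); field.
  by apply/implyP => /eqP; lra.
rewrite mulrDr expRD mulrAC; apply: ler_pM; rewrite ?powR_ge0//.
  apply: (@le_trans _ _ ((expR (3 * N%:R * ln 2 * entropy (marginal T P)) * (A * B * C)) `^ 3^-1)).
    apply: ge0_ler_powR; rewrite ?invr_ge0 ?nnegrE ?exprn_ge0//.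
      by rewrite !mulr_ge0 ?expR_ge0.
    exact: type_class_marginal.
  rewrite powRM ?expR_ge0 ?mulr_ge0// -expRM.
  have -> : 3 * N%:R * ln 2 * entropy (marginal T P) / 3 = N%:R * ln 2 * entropy (marginal T P).
    by field.
  by rewrite ler_wpM2l ?expR_ge0// cube_root_amgm.
have -> : expR (N%:R * ln 2 * ((rho - 2) / 3 * (P0 T P * entropy (Ptilde T P)))) =
   expR (N%:R * P0 T P * ln 2 * entropy (Ptilde T P)) `^ ((rho - 2) / 3).
  by rewrite -expRM; congr expR; ring.
apply: ge0_ler_powR; rewrite ?nnegrE ?expR_ge0//; first by lra.
exact: type_class_Ptilde.
Qed.

End ClassBound.

(** * Values of consistent restrictions *)

Lemma prod_powR (R : realType) (A : finType) (f : A -> R) (p : R) :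
  (forall a, 0 <= f a) -> (\prod_a f a) `^ p = \prod_a f a `^ p.
Proof.
move=> f0; apply: (@proj2 (0 <= \prod_a f a)).
apply: (big_ind2 (fun x y => 0 <= x /\ x `^ p = y)) => [|x x' y y' [x0 <-] [y0 <-]|//].
  by rewrite powR1.
by rewrite mulr_ge0// powRM.
Qed.

Lemma sum_disjoint_le (R : numDomainType) (U V : finType) (Q : {set U})
    (f : U -> {set V}) (w : V -> R) : (forall v, 0 <= w v) ->
  (forall S S' v, S \in Q -> S' \in Q -> v \in f S -> v \in f S' -> S = S') ->
  \sum_(S in Q) \sum_(v in f S) w v <= \sum_v w v.
Proof.
move=> w0 dis; rewrite (exchange_big_dep xpredT)//=; apply: ler_sum => v _.
have [|/existsPn h] := boolP [exists S, (S \in Q) && (v \in f S)]; last first.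
  by rewrite big1 ?w0// => S hS; case/negP: (h S).
case/existsP => S0 /andP[S0Q vS0]; rewrite (big_pred1 S0) ?lexx// => S /=.
by apply/andP/eqP => [[SQ vS]|->//]; exact: dis SQ S0Q vS vS0.
Qed.

Section ValueBound.
Variables (R : realType) (F : fieldType) (D : nat).
Variable T : ptensor F 'I_D.+1 'I_D.+1 'I_D.+1.
Local Notation L := 'I_D.+1.
Local Notation L3 := (L * L * L)%type.
Variable Val : R -> L3 -> R.
Hypotheses (hCW : cw_like T) (hsym : symmetric_ptensor T).
Hypotheses (hest : estimated T Val) (hVsym : symmetric_values T Val).
Variable rho : R.
Hypothesis hrho : 2 <= rho <= 3.

Definition objective_real (P : {ffun L3 -> R}) : R :=
  entropy (marginal T P) + \sum_(s in supp T) P s * (ln (Val rho s) / ln 2) +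
  (rho - 2) / 3 * (P0 T P * entropy (Ptilde T P)).

(** These are the members of sdist(T) with finite objective; on them the real logarithm in
    [objective_real] never meets a zero value with positive weight. *)
Definition admissible (P : {ffun L3 -> R}) : Prop :=
  sdist T P /\ forall s, s \in supp T -> 0 < P s -> 0 < Val rho s.

Section Power.
Variable N : nat.

(** At a zero coordinate the volume is the number of monomials and its power rho/3 is the value of
    the constituent, so every coordinate contributes the value of its annotation. *)
Lemma type_class_value (S : {set pannot L L L 'I_N}) (pi : pattern L L L N) s :
  consistent_for T S pi -> s \in S ->
  (\prod_(t < N | pi t == None) #|monom T (acoord s t)|)%:R `^ (rho / 3) *
  (\prod_(t < N) (if pi t is Some a then Val rho a else 1)) =
  \prod_a Val rho a ^+ atype s a.
Proof.
move=> hS sS; have [hpat hconf _] := hS.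
rewrite -(prod_atype s (Val rho)) big_mkcond natr_prod prod_powR//= -big_split /=.
apply: eq_bigr => t _; have := hconf _ sS t; case: (pi t) => [a ->|s0] /=.
  by rewrite powR1 mul1r.
have [sT /asboolP mm] : acoord s t \in supp T /\ `[< is_matmul (constituent T (acoord s t)) >].
  by move: s0; rewrite inE => /andP.
have [_ /(_ mm) ->] := hest hrho sT.
by have [-> _ _] := Vol_constituent mm; rewrite mulr1.
Qed.

Lemma sum_value_le (S : {set pannot L L L 'I_N}) : consistent T S ->
  sum_value T Val rho S <=
  \sum_(tau : {ffun L3 -> 'I_N.+1})
     #|type_class S tau|%:R `^ (rho / 3) * \prod_a Val rho a ^+ tau a.
Proof.
move=> [pi0 hpi0]; rewrite /sum_value.
have hS : consistent_for T S (pattern_of T S) by rewrite /pattern_of; apply: xgetPex; exists pi0.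
set pi := pattern_of T S in hS *.
have W0 : 0 <= \prod_(t < N) (if pi t is Some a then Val rho a else 1).
  apply: prodr_ge0 => t _; case e: (pi t) => [a|]//.
  have [hpat _ _] := hS; have := hpat _ _ e; rewrite finset.in_setD => /andP[_ aT].
  by have [] := hest hrho aT.
rewrite (Vol_sum0 hS) natr_sum (partition_big (@atype _ N) xpredT)//=.
apply: (@le_trans _ _ ((\sum_(tau : {ffun L3 -> 'I_N.+1})
   (\sum_(s in S | atype s == tau)
      (\prod_(t < N | pi t == None) #|monom T (acoord s t)|)%:R) `^ (rho / 3)) *
   (\prod_(t < N) (if pi t is Some a then Val rho a else 1)))).
  (* As rho <= 3, the exponent is at most 1 and the power is subadditive over the types. *)
  apply: ler_wpM2r => //; apply: powR_sum_le => [tau|]; first exact: sumr_ge0.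
  by move: hrho => /andP[? ?]; apply/andP; split; lra.
rewrite mulr_suml; apply: ler_sum => tau _.
have [c0|[s1 s1C]] := set_0Vmem (type_class S tau).
  rewrite [X in X `^ _ * _]big_pred0 => [|s]; last first.
    apply/negP => h; have : s \in type_class S tau by rewrite inE.
    by rewrite c0 inE.
  have r0 : rho / 3 != 0 by move: hrho => /andP[? ?]; apply/eqP; lra.
  by rewrite c0 cards0 powR0// !mul0r.
have inC s : (s \in S) && (atype s == tau) = (s \in type_class S tau) by rewrite inE.
have [s1S st1] : s1 \in S /\ atype s1 = tau by move: s1C; rewrite inE => /andP[? /eqP].
pose V s := (\prod_(t < N | pi t == None) #|monom T (acoord s t)|)%N.
(* The volume of a term depends only on its type, so within a type class all terms are equal. *)
have VE s : s \in S -> V s = (\prod_a (if a \in supp0 T then #|monom T a| else 1) ^ atype s a)%N.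
  move=> sS; have [hpat hconf _] := hS.
  have := prod_atype s (fun a => if a \in supp0 T then #|monom T a| else 1%N).
  move=> <-; rewrite /V big_mkcond; apply: eq_bigr => t _.
  have := hconf _ sS t; case e: (pi t) => [a|] /= at_; last by rewrite at_.
  by rewrite at_; have := hpat _ _ e; rewrite finset.in_setD => /andP[/negbTE ->].
rewrite (eq_bigl _ _ inC) (eq_bigr (fun=> (V s1)%:R)) => [|s]; last first.
  by rewrite inE => /andP[sS /eqP st]; rewrite -/(V s) !VE// st st1.
rewrite sumr_const -[X in X `^ _]mulr_natl powRM// -mulrA.
by rewrite (type_class_value hS s1S) st1.
Qed.

Lemma profile_value_le (M : R) (Q : {set {set pannot L L L 'I_N}})
    (A : {set {ffun 'I_N -> L}}) (B : {set {ffun 'I_N -> L}}) (C : {set {ffun 'I_N -> L}})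
    (tau : {ffun L3 -> 'I_N.+1}) :
  (0 < N)%N -> (forall P, admissible P -> objective_real P <= M) ->
  consistent_restriction T A B C Q ->
  \sum_(S in Q) #|type_class S tau|%:R `^ (rho / 3) * \prod_a Val rho a ^+ tau a <=
  expR (N%:R * (ln 2 * M)).
Proof.
move=> N0 hM [/and3P[/eqP cov _ _] hcons hdis].
have Qsupp S s : S \in Q -> s \in S -> s \in supp (tpow T 'I_N).
  move=> SQ sS; have : s \in finset.cover Q by apply/finset.bigcupP; exists S.
  by rewrite cov inE => /andP[].
have r0 : rho / 3 != 0 by move: hrho => /andP[? ?]; apply/eqP; lra.
have [ex|/existsPn nex] := boolP [exists S in Q, type_class S tau != finset.set0]; last first.
  rewrite big1 ?expR_ge0// => S SQ; have := nex S; rewrite SQ /= negbK => /eqP ->.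
  by rewrite cards0 powR0// mul0r.
case/exists_inP: ex => S1 S1Q /finset.set0Pn[s1]; rewrite inE => /andP[s1S /eqP st1].
have s1supp : forall t, acoord s1 t \in supp T by apply/supp_tpowP; exact: Qsupp S1Q s1S.
rewrite -mulr_suml; set G := \prod_a _.
(* A type that uses a constituent of value 0 contributes nothing; for any other type the
   distribution P is admissible. *)
have [->|Gn0] := eqVneq G 0; first by rewrite mulr0 expR_ge0.
have Val_gt0 a : (0 < tau a)%N -> 0 < Val rho a.
  move=> ta; have aT : a \in supp T.
    by apply: contraLR ta => aT; rewrite -st1 (atype_nsupp s1supp aT).
  rewrite lt_neqAle; have [-> _] := hest hrho aT; rewrite andbT eq_sym.
  move: Gn0; apply: contraNneq => V0; rewrite /G (bigD1 a)//= V0.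
  by rewrite expr0n (gtn_eqF ta) mul0r.
pose P := symmetrize R tau.
have Pd : sdist T P by rewrite /P -st1; apply: sdist_symmetrize.
have Vrot a : a \in supp T -> Val rho (rot3 a) = Val rho a.
  by case: a => -[i j] k sT; rewrite (hVsym hrho sT).
have Padm : admissible P.
  split=> // a aT; rewrite ffunE => Pa.
  have : (0 < tau a + tau (rot3 a) + tau (rot3 (rot3 a)))%N.
    by rewrite lt0n; apply: contraTneq Pa => ->; rewrite mul0r ltxx.
  rewrite !addn_gt0 => /orP[/orP[]|] /Val_gt0; rewrite ?Vrot// ?rot3_supp//.
have GE : G = expR (N%:R * ln 2 * \sum_(s in supp T) P s * (ln (Val rho s) / ln 2)).
  have := sum_symmetrize tau N0 (fun a => if a \in supp T then ln (Val rho a) else 0).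
  rewrite -/P => e1.
  have -> : N%:R * ln 2 * (\sum_(s in supp T) P s * (ln (Val rho s) / ln 2)) =
      N%:R * \sum_a P a * (if a \in supp T then ln (Val rho a) else 0).
    rewrite -mulrA; congr (_ * _); rewrite mulr_sumr big_mkcond; apply: eq_bigr => a _.
    have := @ln2_gt0 R => l2; case: ifP => _; last by rewrite mulr0.
    by field; exact: lt0r_neq0.
  have {}e1 : N%:R * \sum_a P a * (if a \in supp T then ln (Val rho a) else 0) =
     \sum_a (tau a)%:R * ln (Val rho a).
    apply: (@mulfI R 3); rewrite ?pnatr_eq0// mulrA e1 mulr_sumr; apply: eq_bigr => a _.
    rewrite !rot3_supp//; case: ifP => aT; last by rewrite -st1 (atype_nsupp s1supp (negbT aT)) !mul0r mulr0.
    by rewrite !Vrot ?rot3_supp//; ring.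
  rewrite e1 expR_sum; apply: eq_bigr => a _.
  have [ta|ta] := posnP (tau a); first by rewrite ta expr0 mul0r expR0.
  by rewrite expRM_natl lnK// posrE Val_gt0.
have marg1 := sum_marginal Pd.
have w0 (u : {ffun 'I_N -> L}) : 0 <= \prod_t marginal T P (u t).
  by apply: prodr_ge0 => t _; apply: sumr_ge0 => a _; exact: symmetrize_ge0.
have wsum : \sum_(u : {ffun 'I_N -> L}) \prod_t marginal T P (u t) = 1.
  by rewrite -(bigA_distr_bigA (fun _ => marginal T P)) big1.
have part_sum (f : {set pannot L L L 'I_N} -> {set {ffun 'I_N -> L}}) :
    (forall S S' u, S \in Q -> S' \in Q -> u \in f S -> u \in f S' -> S = S') ->
    \sum_(S in Q) \sum_(u in f S) \prod_t marginal T P (u t) <= 1.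
  by move=> h; rewrite -[leRHS]wsum; apply: sum_disjoint_le.
(* Classes are disjoint in variables, while the weights live on indices. Every index of an
   annotation in the support has a variable, so an index shared by two classes would give a shared
   variable. *)
have ne S s : S \in Q -> s \in S -> exists x y z, [/\ @partX _ _ _ _ (tpow T 'I_N) x = s.1.1,
    @partY _ _ _ _ (tpow T 'I_N) y = s.1.2 & @partZ _ _ _ _ (tpow T 'I_N) z = s.2].
  move=> SQ sS; have := Qsupp _ _ SQ sS; rewrite suppE => /card_gt0P[[[x y] z]].
  by rewrite inE => /andP[/eqP <- _]; exists x, y, z.
have hX : \sum_(S in Q) \sum_(u in [set s.1.1 | s in S]) \prod_t marginal T P (u t) <= 1.
  apply: part_sum => S S' u SQ S'Q /imsetP[s sS us] /imsetP[s' sS' us'].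
  apply/eqP/negPn/negP => SS'; have [dx _ _] := hdis _ _ SQ S'Q SS'.
  have [x [_ [_ [px _ _]]]] := ne _ _ SQ sS.
  have := disjointFr dx (x := x); rewrite !inE => h.
  have /h/negbT/negP : [exists s in S, partX x == s.1.1] by apply/exists_inP; exists s => //; apply/eqP.
  by case; apply/exists_inP; exists s' => //; rewrite px -us us'.
have hY : \sum_(S in Q) \sum_(u in [set s.1.2 | s in S]) \prod_t marginal T P (u t) <= 1.
  apply: part_sum => S S' u SQ S'Q /imsetP[s sS us] /imsetP[s' sS' us'].
  apply/eqP/negPn/negP => SS'; have [_ dx _] := hdis _ _ SQ S'Q SS'.
  have [_ [x [_ [_ px _]]]] := ne _ _ SQ sS.
  have := disjointFr dx (x := x); rewrite !inE => h.
  have /h/negbT/negP : [exists s in S, partY x == s.1.2] by apply/exists_inP; exists s => //; apply/eqP.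
  by case; apply/exists_inP; exists s' => //; rewrite px -us us'.
have hZ : \sum_(S in Q) \sum_(u in [set s.2 | s in S]) \prod_t marginal T P (u t) <= 1.
  apply: part_sum => S S' u SQ S'Q /imsetP[s sS us] /imsetP[s' sS' us'].
  apply/eqP/negPn/negP => SS'; have [_ _ dx] := hdis _ _ SQ S'Q SS'.
  have [_ [_ [x [_ _ px]]]] := ne _ _ SQ sS.
  have := disjointFr dx (x := x); rewrite !inE => h.
  have /h/negbT/negP : [exists s in S, partZ x == s.2] by apply/exists_inP; exists s => //; apply/eqP.
  by case; apply/exists_inP; exists s' => //; rewrite px -us us'.
pose h := entropy (marginal T P) + (rho - 2) / 3 * (P0 T P * entropy (Ptilde T P)).
have le1 : \sum_(S in Q) #|type_class S tau|%:R `^ (rho / 3) <= expR (N%:R * ln 2 * h).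
  apply: (@le_trans _ _ (\sum_(S in Q) expR (N%:R * ln 2 * h) *
    ((\sum_(u in [set s.1.1 | s in S]) \prod_t marginal T P (u t) +
      \sum_(u in [set s.1.2 | s in S]) \prod_t marginal T P (u t) +
      \sum_(u in [set s.2 | s in S]) \prod_t marginal T P (u t)) / 3))).
    apply: ler_sum => S /hcons[pi hS]; exact: type_class_power hS _ _ hrho.
  (* Each of the x-, y- and z-sums totals at most 1 over the classes, hence so does their mean. *)
  rewrite -mulr_sumr -mulr_suml !big_split /= -[leRHS]mulr1 ler_wpM2l ?expR_ge0//.
  by rewrite ler_pdivrMr//; lra.
apply: (@le_trans _ _ (expR (N%:R * ln 2 * h) * G)).
  by rewrite ler_wpM2r// GE expR_ge0.
rewrite GE -expRD ler_expR -mulrDr -mulrA ler_wpM2l// ler_wpM2l ?(ltW (ln2_gt0 _))//.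
by apply: le_trans (hM _ Padm); rewrite /objective_real /h; lra.
Qed.

End Power.

Lemma VmN_ge0 N : 0 <= VmN T Val rho N.
Proof. by rewrite /VmN; apply: bigmax_ge_id. Qed.

Lemma VmN_le (M : R) N : (0 < N)%N ->
  (forall P, admissible P -> objective_real P <= M) ->
  VmN T Val rho N <= N.+1%:R ^+ #|{: L3}| * expR (N%:R * (ln 2 * M)).
Proof.
move=> N0 hM; apply: bigmax_le => [|[[[A B] C] Q] /asboolP /= hQ].
  by rewrite mulr_ge0 ?exprn_ge0 ?expR_ge0.
have [_ hcons _] := hQ.
apply: (@le_trans _ _ (\sum_(tau : {ffun L3 -> 'I_N.+1}) \sum_(S in Q)
    #|type_class S tau|%:R `^ (rho / 3) * \prod_a Val rho a ^+ tau a)).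
  by rewrite exchange_big; apply: ler_sum => S /hcons; exact: sum_value_le.
apply: (@le_trans _ _ (\sum_(tau : {ffun L3 -> 'I_N.+1}) expR (N%:R * (ln 2 * M)))).
  by apply: ler_sum => tau _; exact: profile_value_le hQ.
by rewrite sumr_const card_ffun card_ord -[leLHS]mulr_natl natrX.
Qed.

Lemma elog2_Vm_le (M : R) : (forall P, admissible P -> objective_real P <= M) ->
  (elog2 (Vm T Val rho) <= M%:E)%E.
Proof.
move=> hM; have l2 := @ln2_gt0 R.
have Vle : Vm T Val rho <= expR (ln 2 * M).
  by apply: lim_root_le => N; [exact: VmN_ge0 | move=> N0; exact: VmN_le].
(* For Vm = 0 the left side is -oo. *)
rewrite /elog2; have [V0|V0] := leP (Vm T Val rho) 0.
  by rewrite le0_lneNy ?lee_fin// mulNyr gtr0_sg ?invr_gt0// mul1e leNye.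
rewrite lne_EFin// -EFinM lee_fin ler_pdivrMr// mulrC -ler_expR lnK//.
Qed.

End ValueBound.

(** * Existence of the maximum *)

Section Maximizer.
Variables (R : realType) (F : fieldType) (D : nat).
Variable T : ptensor F 'I_D.+1 'I_D.+1 'I_D.+1.
Local Notation L := 'I_D.+1.
Local Notation L3 := (L * L * L)%type.
Variable Val : R -> L3 -> R.
Hypotheses (hCW : cw_like T) (hsym : symmetric_ptensor T).
Variable rho : R.

(* Multiplying by P0 removes the singularity of the entropy of Ptilde at
   P0 = 0. *)
Lemma P0_entropy_Ptilde (P : {ffun L3 -> R}) : sdist T P ->
  P0 T P * entropy (Ptilde T P) =
  - ((\sum_i unzero T P i / 2 * ln (unzero T P i / 2) - P0 T P * ln (P0 T P)) / ln 2).
Proof.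
move=> hP; have l2 := ln2_gt0 R; have l2n : ln 2 != 0 :> R by exact: lt0r_neq0.
have uE i : P0 T P * Ptilde T P i = unzero T P i / 2.
  by rewrite -(Ptilde_unzero hCW hsym hP); field.
have [P00|P0n] := eqVneq (P0 T P) 0.
  rewrite P00 !mul0r big1 => [|i _]; first by rewrite subr0 mul0r oppr0.
  by rewrite -uE P00 !mul0r.
have Ppos : 0 < P0 T P by rewrite lt_neqAle eq_sym P0n (P0_ge0 hP).
rewrite /entropy mulrN; congr (- _).
have -> : P0 T P * ln (P0 T P) = \sum_i unzero T P i / 2 * ln (P0 T P).
  by rewrite -mulr_suml -mulr_suml (sum_unzero hCW); field.
rewrite -sumrB mulr_sumr mulr_suml; apply: eq_bigr => i _.
have [p0|pn] := eqVneq (Ptilde T P i) 0.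
  have -> : unzero T P i = 0.
    by rewrite -(Ptilde_unzero hCW hsym hP) p0 mulr0.
  by rewrite p0 !mul0r subrr mul0r mulr0.
have ppos : 0 < Ptilde T P i by rewrite lt_neqAle eq_sym pn Ptilde_ge0.
by rewrite -uE lnM ?posrE//; field.
Qed.

Lemma objective_admissible (P : {ffun L3 -> R}) : admissible T Val rho P ->
  objective T Val rho P = (objective_real T Val rho P)%:E.
Proof.
move=> [hP hV]; rewrite /objective /objective_real !EFinD; congr (_ + _ + _)%E.
rewrite -sumEFin; apply: eq_bigr => s sT; rewrite /elog2.
have [->|Pn] := eqVneq (P s) 0; first by rewrite mul0e mul0r.
have Pp : 0 < P s by rewrite lt_neqAle eq_sym Pn (sdist_ge0 hP).
by rewrite lne_EFin ?hV// -!EFinM.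
Qed.

Lemma objective_not_admissible (P : {ffun L3 -> R}) :
  sdist T P -> ~ admissible T Val rho P -> objective T Val rho P = -oo%E.
Proof.
move=> hP hn; have /existsNP[s /not_implyP[sT /not_implyP[Pp /negP]]] :
    ~ forall s, s \in supp T -> 0 < P s -> 0 < Val rho s by move=> h; apply: hn; split.
rewrite -leNgt => V0; rewrite /objective (bigD1 s)//=.
rewrite {1}/elog2 le0_lneNy ?lee_fin//.
have l2 : 0 < (ln 2)^-1 :> R by rewrite invr_gt0 ln2_gt0.
by rewrite gt0_mulNye ?lte_fin// gt0_muleNy ?lte_fin.
Qed.

(** The values do not depend on P, so the condition on positive weights amounts to equations P(s) =
    0 for a fixed set of s; in this form the set is closed. *)
Lemma admissibleP (P : {ffun L3 -> R}) : admissible T Val rho P <->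
  [/\ forall s, 0 <= P s,
      forall s, (s \notin supp T) || (Val rho s <= 0) -> P s = 0,
      \sum_s P s = 1 &
      forall s, P s = P (rot3 s)].
Proof.
split=> [[[h1 h2 h3 h4] h5]|[h1 h2 h3 h4]].
  split=> // [s|[[i j] k]]; last exact: h4.
  have [sT|/h2//] := boolP (s \in supp T); rewrite /= leNgt => V0.
  by apply/eqP; rewrite eq_le h1 andbT leNgt; apply: contra V0; exact: h5.
split; first split=> //.
  by move=> s sT; apply: h2; rewrite sT.
move=> s sT; rewrite !ltNge; apply: contra => V0.
by rewrite h2 ?lexx// V0 orbT.
Qed.

Lemma closed_forall (U : topologicalType) (I : Type) (A : I -> U -> Prop) :
  (forall i, closed [set x | A i x]%classic) -> closed [set x | forall i, A i x]%classic.
Proof.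
move=> cA; have -> : [set x | forall i, A i x]%classic =
    (\bigcap_(i in setT) [set x | A i x])%classic.
  by apply/seteqP; split=> x /= h i; [move=> _; exact: h | exact: h].
exact: closed_bigI.
Qed.

Section Coordinates.
Local Notation n := #|{: L3}|.

Definition dist_of_row (v : 'rV[R]_n) : {ffun L3 -> R} := [ffun a => v ord0 (enum_rank a)].

Lemma continuous_sumr (I : finType) (Q : pred I) (f : I -> 'rV[R]_n -> R) :
  (forall i, continuous (f i)) -> continuous (fun x => \sum_(i | Q i) f i x).
Proof.
by move=> cf; apply: continuous_big => [|i _]; [exact: add_continuous|exact: cf].
Qed.

Lemma continuous_dist_of_row a : continuous (fun v => dist_of_row v a).
Proof.
have -> : (fun v => dist_of_row v a) = (fun v : 'rV[R]_n => v ord0 (enum_rank a)).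
  by apply/funext => v; rewrite ffunE.
exact: coord_continuous.
Qed.

Lemma continuous_mulr_cst (f : 'rV[R]_n -> R) (c : R) :
  continuous f -> continuous (fun v => f v * c).
Proof. by move=> cf v; exact: (cvgM (cf v) (cvg_cst c)). Qed.

Lemma closed_admissible : closed [set v | admissible T Val rho (dist_of_row v)]%classic.
Proof.
have -> : [set v | admissible T Val rho (dist_of_row v)]%classic =
  ([set v | forall s, 0 <= dist_of_row v s] `&`
   ([set v | forall s, (s \notin supp T) || (Val rho s <= 0) -> dist_of_row v s = 0%R] `&`
   ([set v | (\sum_s dist_of_row v s)%R = 1%R] `&`
    [set v | forall s, dist_of_row v s - dist_of_row v (rot3 s) = 0])))%classic.
  apply/seteqP; split=> v /=.
    move/admissibleP => [h1 h2 h3 h4]; do !split=> //.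
    by move=> s; rewrite {1}h4 subrr.
  move=> [h1 [h2 [h3 h4]]]; apply/admissibleP; split=> // s.
  by apply/eqP; rewrite -subr_eq0 h4.
have pre (f : 'rV[R]_n -> R) (A : set R) : continuous f -> closed A -> closed (f @^-1` A)%classic.
  by move=> cf cA; apply: preimage_closed => // v _; exact: cf.
apply: closedI.
  apply: closed_forall => s.
  exact: (pre (fun v => dist_of_row v s) [set x | 0 <= x]%classic (@continuous_dist_of_row s) (@closed_ge R 0)).
apply: closedI.
  apply: closed_forall => s; case: (_ || _).
    have -> : [set v | true -> dist_of_row v s = 0]%classic = [set v | dist_of_row v s = 0]%classic.
      by apply/seteqP; split=> v /=; [exact | move=> ->].
    exact: (pre (fun v => dist_of_row v s) [set x | x = 0]%classic (@continuous_dist_of_row s) (@closed_eq R 0)).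
  have -> : [set v | false -> dist_of_row v s = 0]%classic = setT by apply/seteqP; split.
  exact: closedT.
apply: closedI.
  apply: (pre (fun v => \sum_s dist_of_row v s) [set x | x = 1]%classic _ (@closed_eq R 1)).
  by apply: continuous_sumr => s; exact: continuous_dist_of_row.
apply: closed_forall => s.
apply: (pre (fun v => dist_of_row v s - dist_of_row v (rot3 s)) [set x | x = 0]%classic _ (@closed_eq R 0)).
by move=> v; exact: (cvgB (@continuous_dist_of_row s v) (@continuous_dist_of_row (rot3 s) v)).
Qed.

Lemma compact_admissible : compact [set v | admissible T Val rho (dist_of_row v)]%classic.
Proof.
have cI : compact [set v : 'rV[R]_n | forall i, `[(0 : R), 1]%classic (v ord0 i)]%classic.
  by apply: (@rV_compact R n (fun=> `[(0 : R), 1]%classic)) => _; exact: segment_compact.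
apply: (subclosed_compact closed_admissible cI).
move=> v /= [[h1 _ h3 _] _] i; rewrite /= in_itv /=.
have e : dist_of_row v (enum_val i) = v ord0 i by rewrite ffunE enum_valK.
rewrite -e h1 /= -h3 (bigD1 (enum_val i))//= lerDl.
by apply: sumr_ge0.
Qed.

(** All nonlinear terms have the form x ln x, with no division by P_0, so this expression is
    continuous on every row vector, including those that are not distributions. *)
Definition regular_objective (v : 'rV[R]_n) : R :=
  - \sum_i marginal T (dist_of_row v) i * ln (marginal T (dist_of_row v) i) / ln 2 +
  \sum_(s in supp T) dist_of_row v s * (ln (Val rho s) / ln 2) +
  (- (\sum_i unzero T (dist_of_row v) i / 2 * ln (unzero T (dist_of_row v) i / 2) -
     P0 T (dist_of_row v) * ln (P0 T (dist_of_row v)))) * ((rho - 2) / 3 / ln 2).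

Lemma regular_objectiveE v : sdist T (dist_of_row v) -> objective_real T Val rho (dist_of_row v) = regular_objective v.
Proof.
move=> hv; rewrite /objective_real /regular_objective P0_entropy_Ptilde//; congr (_ + _ + _).
  by rewrite /entropy; congr (- _); apply: eq_bigr => i _; rewrite mulrA.
by field; exact: lt0r_neq0 (ln2_gt0 R).
Qed.

Lemma continuous_regular_objective : continuous regular_objective.
Proof.
have cx (f : 'rV[R]_n -> R) : continuous f -> continuous (fun v => f v * ln (f v)).
  by move=> cf v; exact: (continuous_comp (cf v) (@xlnx_continuous R (f v))).
have cm i : continuous (fun v => marginal T (dist_of_row v) i).
  by apply: continuous_sumr => s; exact: continuous_dist_of_row.
have cP : continuous (fun v => P0 T (dist_of_row v)).
  by apply: continuous_sumr => s; exact: continuous_dist_of_row.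
have cu i : continuous (fun v => unzero T (dist_of_row v) i / 2).
  apply: continuous_mulr_cst; apply: continuous_sumr => s.
  by apply: continuous_mulr_cst; exact: continuous_dist_of_row.
have c1 : continuous (fun v => \sum_i marginal T (dist_of_row v) i * ln (marginal T (dist_of_row v) i) / ln 2).
  by apply: continuous_sumr => i; apply: continuous_mulr_cst; exact: cx.
have c2 : continuous (fun v => \sum_(s in supp T) dist_of_row v s * (ln (Val rho s) / ln 2)).
  by apply: continuous_sumr => s; apply: continuous_mulr_cst; exact: continuous_dist_of_row.
have c3 : continuous (fun v =>
    \sum_i unzero T (dist_of_row v) i / 2 * ln (unzero T (dist_of_row v) i / 2)).
  by apply: continuous_sumr => i; exact: cx.
have c4 : continuous (fun v => - (\sum_i unzero T (dist_of_row v) i / 2 * ln (unzero T (dist_of_row v) i / 2) -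
     P0 T (dist_of_row v) * ln (P0 T (dist_of_row v)))).
  by move=> v; exact: (cvgN (cvgB (c3 v) (cx _ cP v))).
have c5 := continuous_mulr_cst (c := (rho - 2) / 3 / ln 2) c4.
by move=> v; exact: (cvgD (cvgD (cvgN (c1 v)) (c2 v)) (c5 v)).
Qed.

Lemma objective_has_max : (exists P, admissible T Val rho P) ->
  exists2 P, admissible T Val rho P &
    forall Q, sdist T Q -> (objective T Val rho Q <= objective T Val rho P)%E.
Proof.
move=> [P1 hP1].
pose K := [set v | admissible T Val rho (dist_of_row v)]%classic.
have surj P : exists v, dist_of_row v = P.
  exists (\row_i P (enum_val i)); apply/ffunP => a; rewrite ffunE mxE enum_rankK //.
have K0 : (K !=set0)%classic by have [v e] := surj P1; exists v; rewrite /K /= e.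
have [v vK vmax] := EVT_max_rV K0 compact_admissible (continuous_subspaceT continuous_regular_objective).
have {}vK : admissible T Val rho (dist_of_row v) by move: vK; rewrite inE.
exists (dist_of_row v) => // Q hQ; rewrite (objective_admissible vK).
(* Outside the admissible set the objective is -oo, so the maximum over the compact admissible set
   is the maximum over sdist(T). *)
have [aQ|naQ] := pselect (admissible T Val rho Q); last first.
  by rewrite objective_not_admissible// leNye.
have [w we] := surj Q; rewrite (objective_admissible aQ) lee_fin -we.
rewrite !regular_objectiveE; [|by case: vK|by rewrite we].
by apply: vmax; rewrite inE /K /= we.
Qed.

End Coordinates.
End Maximizer.

Lemma admissible_exists (R : realType) (F : fieldType) (D : nat)
    (T : ptensor F 'I_D.+1 'I_D.+1 'I_D.+1)
    (Val : R -> 'I_D.+1 * 'I_D.+1 * 'I_D.+1 -> R) (rho : R) :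
  cw_like T -> symmetric_ptensor T -> estimated T Val -> 2 <= rho <= 3 ->
  exists P, admissible T Val rho P.
Proof.
move=> hCW hsym hest hrho.
pose a0 : 'I_D.+1 * 'I_D.+1 * 'I_D.+1 := (ord_max, ord0, ord0).
have a0T : a0 \in supp T.
  by have [_ _ _ h] := hCW; rewrite /a0 h ?inE ?eqxx ?orbT.
(* An annotation of the first power: its symmetrized type is the average of the rotations of (D, 0,
   0), whose constituents are matrix multiplication tensors and so have positive value. *)
pose s0 : pannot 'I_D.+1 'I_D.+1 'I_D.+1 'I_1 :=
  ([ffun=> ord_max], [ffun=> ord0], [ffun=> ord0]).
have s0E t : acoord s0 t = a0 by rewrite /acoord /= !ffunE.
exists (symmetrize R (atype s0)); split.
  by apply: sdist_symmetrize => // t; rewrite s0E.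
have pos a : a \in supp0 T -> 0 < Val rho a.
  rewrite inE => /andP[aT /asboolP mm]; have [_ /(_ mm) ->] := hest _ _ hrho aT.
  have [-> m0 _] := Vol_constituent mm.
  by apply: powR_gt0; rewrite ltr0n.
have a00 : a0 \in supp0 T by rewrite /a0 (supp0_zero hCW) -/a0 a0T /= orbT.
move=> s sT Ps; apply: pos; move: Ps; rewrite ffunE; apply: contraTT => ns.
have z a : a \notin supp0 T -> atype s0 a = 0%N :> nat.
  by move=> na; apply: atype_eq0 => t; rewrite s0E; apply: contraNneq na => <-.
by rewrite !z ?rot3_supp0// mul0r ltxx.
Qed.

Theorem mainTheorem10 (R : realType) (F : fieldType) (D : nat)
    (T : ptensor F 'I_D.+1 'I_D.+1 'I_D.+1)
    (Val : R -> 'I_D.+1 * 'I_D.+1 * 'I_D.+1 -> R)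
    (hCW : cw_like T) (hsym : symmetric_ptensor T)
    (hest : estimated T Val) (hVsym : symmetric_values T Val)
    (rho : R) (hrho : 2 <= rho <= 3) :
  exists P : {ffun 'I_D.+1 * 'I_D.+1 * 'I_D.+1 -> R},
    [/\ sdist T P,
        forall Q : {ffun 'I_D.+1 * 'I_D.+1 * 'I_D.+1 -> R},
          sdist T Q -> (objective T Val rho Q <= objective T Val rho P)%E &
        (elog2 (Vm T Val rho) <= objective T Val rho P)%E].
Proof.
have [P hP hmax] := objective_has_max hCW hsym (admissible_exists hCW hsym hest hrho).
exists P; split=> //; first by case: hP.
rewrite (objective_admissible hP); apply: elog2_Vm_le => // Q hQ.
rewrite -lee_fin -(objective_admissible hP) -(objective_admissible hQ).
by apply: hmax; case: hQ.
Qed.
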